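(* Let $W\in\tilde{\mathcal W}_q(\mathbf G^* )$. Then for subsets $S\subseteq \mathbf G\setminus\{0\}$, $$P_SI = I-(I-\tilde I_S,I)_\sim^{-1}\,(I-\tilde I_S)\,W^{-1}$$ and $$\Delta_S=(I-\tilde I_S,I)_\sim^{-1}=(I-\tilde I_S,I-\tilde I_S)_\sim^{-1}.$$
   Context: $\mathbf G$ is a discrete abelian group with neutral element $0$, $\mathbf G^*$ its compact dual group, $\lambda$ the Haar measure on $\mathbf G^*$ with $\lambda(\mathbf G^* )=1$. Integrals are over $\mathbf G^*$; relations between measurable functions hold $\lambda$-a.e. For $q\in\mathbb N=\{1,2,\dots\}$, $\mathbf M_q$ is the algebra of complex $q\times q$ matrices, $I$ the identity matrix (also viewed as a constant function), $\mathrm{tr}$ the normalized trace ($\mathrm{tr}\,I=1$). $\mathcal W_q(\mathbf G^* )$ is the set of integrable functions on $\mathbf G^*$ with values in the positive (definite) Hermitian $q\times q$ matrices; $\tilde{\mathcal W}_q(\mathbf G^* )$ is the set of $W\in\mathcal W_q(\mathbf G^* )$ with $W^{-1}$ integrable. $L^2(W)$ is the left Hilbert $\mathbf M_q$-module of (classes of) measurable $F:\mathbf G^*\to\mathbf M_q$ with $\mathrm{tr}(FWF^* )$ integrable, with $\mathbf M_q$-valued inner product $(F,G)=\int FWG^*\,d\lambda$, scalar product $\langle F,G\rangle=\mathrm{tr}(F,G)$ and norm $\|F\|=\langle F,F\rangle^{1/2}$. The corresponding objects for $L^2(W^{-1})$ are denoted with a $\sim$: $(F,G)_\sim=\int FW^{-1}G^*\,d\lambda$,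 etc. For $S\subseteq\mathbf G$, $\mathcal T(S)$ is the left $\mathbf M_q$-module of all $\mathbf M_q$-valued trigonometric polynomials with frequencies in $S$ (finite sums $\sum_{g\in S}A_g\chi_g$, $A_g\in\mathbf M_q$, $\chi_g$ the character of $\mathbf G^*$ defined by $g$; $\mathcal T(\emptyset)=\{0\}$), $\mathcal M(S)$ is its closure in $L^2(W)$, $P_S$ is the orthogonal projection of $L^2(W)$ onto $\mathcal M(S)$, and $S^0=S\cup\{0\}$. For $S\subseteq\mathbf G\setminus\{0\}$ the prediction error matrix is $\Delta_S=(I-P_SI,I-P_SI)$. For a submodule $\mathcal M$ of $L^2(W)$, its dual is $\mathcal M^d=\{G\in L^2(W^{-1}):\int FG^*\,d\lambda=0 \text{ for all }F\in\mathcal M\}$ (for $W\in\tilde{\mathcal W}_q(\mathbf G^* )$ the integrals exist). $\tilde I_S$ denotes the orthogonal projection, in $L^2(W^{-1})$, of $I$ onto $\mathcal M(S^0)^d$. *)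

(* Defs.v *)
From HB Require Import structures.
From mathcomp Require Import all_boot all_order all_algebra.
From mathcomp Require Import complex.
From mathcomp Require Import all_classical all_reals all_analysis.

Set Implicit Arguments.
Unset Strict Implicit.
Unset Printing Implicit Defensive.

Import Order.TTheory GRing.Theory Num.Theory.
Import numFieldNormedType.Exports.

Local Open Scope classical_set_scope.
Local Open Scope ring_scope.
Local Open Scope sesquilinear_scope.
Local Open Scope complex_scope.

(** The dual of a discrete abelian group [G]: all homomorphisms from [G] to the
    unit circle. The group [G] is written additively, the dual
    multiplicatively. *)

Definition is_character (R : realType) (G : zmodType) (f : G -> R[i]) : Prop :=
  (forall g, `|f g| = 1) /\ (forall g h, f (g + h) = f g * f h).

Record dual (R : realType) (G : zmodType) : Type := Dual {
  dual_fun :> G -> R[i];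
  dualP : is_character dual_fun }.

Section dual_structures.
Variables (R : realType) (G : zmodType).

Lemma is_character1 : is_character (fun _ : G => 1 : R[i]).
Proof. by split=> [g|g h]; rewrite ?normr1 ?mulr1. Qed.

Definition dual1 : dual R G := Dual is_character1.

Lemma is_characterM (x y : dual R G) : is_character (fun g => x g * y g).
Proof.
case: x y => [x [x1 xD]] [y [y1 yD]]; split=> [g|g h] /=.
  by rewrite normrM x1 y1 mulr1.
by rewrite xD yD mulrACA.
Qed.

Definition dual_mul (x y : dual R G) : dual R G := Dual (is_characterM x y).

HB.instance Definition _ := gen_eqMixin (dual R G).
HB.instance Definition _ := gen_choiceMixin (dual R G).
HB.instance Definition _ := isPointed.Build (dual R G) dual1.

(* As [G] is discrete, its compact subsets are the finite ones, so that the
   compact-open topology of the dual is the topology of pointwise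
   convergence. *)
HB.instance Definition _ := Topological.copy (dual R G)
  (initial_topology
    (@dual_fun R G : dual R G -> prod_topology (fun _ : G => R[i]^o))).

(* The Borel sigma-algebra of the dual. For uncountable [G] it is larger than
   the trace of the product sigma-algebra. *)
HB.instance Definition _ := Measurable.copy (dual R G)
  (g_sigma_algebraType (@open (dual R G))).

End dual_structures.

(** The normalized Haar measure: the regular translation-invariant Borel
    probability measure. *)

Definition is_haar (R : realType) (G : zmodType)
    (mu : probability (dual R G) R) : Prop :=
  [/\ forall (x : dual R G) (A : set (dual R G)),
        measurable A -> mu (dual_mul x @` A) = mu A,
      forall A : set (dual R G), measurable A ->
        mu A = ereal_inf [set mu U | U in [set U | open U /\ A `<=` U]]
    & forall U : set (dual R G), open U ->
        mu U = ereal_sup [set mu K | K in [set K | compact K /\ K `<=` U]]].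

(** Matrices *)

Definition posdefmx (R : realType) (q : nat) (A : 'M[R[i]]_q) : Prop :=
  A \is hermsymmx /\
  forall v : 'rV[R[i]]_q, v != 0 -> 0 < (v *m A *m v^t*) 0 0.

Definition ntr (R : realType) (q : nat) (A : 'M[R[i]]_q) : R[i] :=
  \tr A / q%:R.

(** Measurability and integration of complex and of matrix-valued functions *)

Section integration.
Context (d : measure_display) (T : measurableType d) (R : realType).
Variable mu : {measure set T -> \bar R}.

Definition cmeasurable (f : T -> R[i]) : Prop :=
  measurable_fun setT (fun x => complex.Re (f x)) /\
  measurable_fun setT (fun x => complex.Im (f x)).

Definition cintegrable (f : T -> R[i]) : Prop :=
  mu.-integrable setT (fun x => (complex.Re (f x))%:E) /\
  mu.-integrable setT (fun x => (complex.Im (f x))%:E).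

Definition cintegral (f : T -> R[i]) : R[i] :=
  Rintegral mu setT (fun x => complex.Re (f x)) +i*
  Rintegral mu setT (fun x => complex.Im (f x)).

Definition mxmeasurable (q : nat) (F : T -> 'M[R[i]]_q) : Prop :=
  forall i j, cmeasurable (fun x => F x i j).

Definition mxintegrable (q : nat) (F : T -> 'M[R[i]]_q) : Prop :=
  forall i j, cintegrable (fun x => F x i j).

Definition mxintegral (q : nat) (F : T -> 'M[R[i]]_q) : 'M[R[i]]_q :=
  \matrix_(i, j) cintegral (fun x => F x i j).

Definition weight (q : nat) (W : T -> 'M[R[i]]_q) : Prop :=
  mxintegrable W /\ {ae mu, forall x, posdefmx (W x)}.

Definition invweight (q : nat) (W : T -> 'M[R[i]]_q) : T -> 'M[R[i]]_q :=
  fun x => invmx (W x).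

Definition weight_tilde (q : nat) (W : T -> 'M[R[i]]_q) : Prop :=
  weight W /\ mxintegrable (invweight W).

(** The left module [L^2(V)] of a weight [V]. Its elements are functions rather
    than classes of functions modulo equality almost everywhere, and its
    subspaces are sets of functions. *)

Section L2.
Variables (q : nat) (V : T -> 'M[R[i]]_q).

Definition L2 : set (T -> 'M[R[i]]_q) :=
  [set F | mxmeasurable F /\
           cintegrable (fun x => ntr (F x *m V x *m (F x)^t*))].

Definition mxip (F H : T -> 'M[R[i]]_q) : 'M[R[i]]_q :=
  mxintegral (fun x => F x *m V x *m (H x)^t*).

Definition scalar_prod (F H : T -> 'M[R[i]]_q) : R[i] := ntr (mxip F H).

Definition L2norm (F : T -> 'M[R[i]]_q) : R :=
  Num.sqrt (complex.Re (scalar_prod F F)).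

Definition L2closure (M : set (T -> 'M[R[i]]_q)) : set (T -> 'M[R[i]]_q) :=
  [set F | L2 F /\
           forall e : R, 0 < e -> exists2 H, M H & L2norm (F \- H) < e].

Definition is_orthproj (M : set (T -> 'M[R[i]]_q))
    (F P : T -> 'M[R[i]]_q) : Prop :=
  M P /\ forall H, M H -> scalar_prod (F \- P) H = 0.

(* A representative of the orthogonal projection of [F] onto [M]; the default
   value 0 is only used when there is no projection. *)
Definition orthproj (M : set (T -> 'M[R[i]]_q)) (F : T -> 'M[R[i]]_q) :
    T -> 'M[R[i]]_q :=
  xget (fun=> 0) [set P | is_orthproj M F P].

End L2.

Definition dualmod (q : nat) (W : T -> 'M[R[i]]_q)
    (M : set (T -> 'M[R[i]]_q)) : set (T -> 'M[R[i]]_q) :=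
  [set H | L2 (invweight W) H /\
           forall F, M F -> mxintegral (fun x => F x *m (H x)^t*) = 0].

End integration.

(** Trigonometric polynomials and prediction *)

Section prediction.
Variables (R : realType) (G : zmodType) (mu : probability (dual R G) R).
Variable q : nat.

(* The value at [x] of the character of the dual defined by [g] is [x g]. *)
Definition trigpoly (S : set G) : set (dual R G -> 'M[R[i]]_q) :=
  [set F | exists (s : seq G) (A : G -> 'M[R[i]]_q),
     (forall g, g \in s -> S g) /\
     F = (fun x : dual R G => \sum_(g <- s) x g *: A g)].

Variable W : dual R G -> 'M[R[i]]_q.

Definition MS (S : set G) : set (dual R G -> 'M[R[i]]_q) :=
  L2closure mu W (trigpoly S).

Definition Iconst : dual R G -> 'M[R[i]]_q := fun=> 1%:M.

Definition PSI (S : set G) : dual R G -> 'M[R[i]]_q :=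
  orthproj mu W (MS S) Iconst.

Definition Delta (S : set G) : 'M[R[i]]_q :=
  mxip mu W (Iconst \- PSI S) (Iconst \- PSI S).

Definition Itilde (S : set G) : dual R G -> 'M[R[i]]_q :=
  orthproj mu (invweight W) (dualmod mu W (MS (S `|` [set 0]))) Iconst.

End prediction.

(* Main.v *)
Require Import Defs.
From HB Require Import structures.
From mathcomp Require Import all_boot all_order all_algebra.
From mathcomp Require Import complex.
From mathcomp Require Import all_classical all_reals all_analysis.
From mathcomp Require Import measurable_realfun.
From mathcomp Require Import ring lra.

(** The idea is to carry everything out in [L^2(W)]. Right multiplication by [W]
    is an isometry of [L^2(W)] onto [L^2(W^-1)] ([mxip_mulr_weight]), and since
    the integral of [F H^*] is the inner product [(F, H W^-1)] of [L^2(W)]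
    ([mxintegral_mul_adj]), it carries the orthogonal complement of a submodule
    onto the dual of the submodule. As [W^-1] is integrable, it is an element
    of [L^2(W)], and it represents integration: [(F, W^-1)] is the integral of
    [F] ([mxip_invweight]). Nontrivial characters have mean zero, so [W^-1] is
    orthogonal to [T(S)], hence to [M(S)], while [(I, W^-1) = I].

    Let [Z = I - P_S I], so that [(Z, I) = (Z, Z) = Delta_S] and
    [(Z, W^-1) = I]. If [A Delta_S = 0] then [A Z = 0], and [A = (A Z, W^-1)]
    vanishes: [Delta_S] is invertible. Now put [Y = Delta_S^-1 Z W]. Then
    [I - Y] is the projection of [I] onto the dual of [M(S^0)]: its preimage
    [W^-1 - Delta_S^-1 Z] in [L^2(W)] is orthogonal to [T(S)] and also to the
    constants, by the value of [(Z, I)], whereas the preimage [Delta_S^-1 Z] of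
    [Y] lies in [M(S^0)] itself. So [I - Itilde_S = Y] almost everywhere by
    uniqueness of projections ([Itilde_residual_ae]), and the formulas are read
    off: [(Y, I)~ = Delta_S^-1 (Z, W^-1)] and
    [(Y, Y)~ = Delta_S^-1 (Z, Z) Delta_S^-1] are both [Delta_S^-1].

    Two facts have to be established first. The projection [P_S I] exists
    because [L^2(W)] is complete ([L2_complete]); here again [W^-1] helps, since
    it bounds the [L^1] norm of each entry of [F] by the norm of [F] in
    [L^2(W)], so that a fast Cauchy sequence converges almost everywhere and
    Fatou's lemma applies. Nontrivial characters have mean zero
    ([cintegral_dual_eq0]) because translation by [x0] multiplies the mean of
    the character [g] by [x0 g], and because for [g] different from [0] some
    [x0] in the dual group has [x0 g] different from [1], by Zorn's lemma
    ([exists_character_neq1]). *)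

Set Implicit Arguments.
Unset Strict Implicit.
Unset Printing Implicit Defensive.

Import Order.TTheory GRing.Theory Num.Theory.
Import numFieldNormedType.Exports.

Local Open Scope classical_set_scope.
Local Open Scope ring_scope.
Local Open Scope complex_scope.

(** * Separation of points by characters *)

Section characters.
Variables (R : realType) (G : zmodType).
Local Notation C := (R[i]).
Implicit Types (X Y : set (G * C)) (g h : G) (z w c : C).

(** The graph of a character of a subgroup, or the empty set. Graphs, rather
    than functions with a domain, are ordered by inclusion and have unions as
    upper bounds of chains. Given the first condition, the last one expresses
    single-valuedness. *)
Definition partial_character X : Prop :=
  [/\ forall g h z w, X (g, z) -> X (h, w) -> X (g - h, z / w),
      forall g z, X (g, z) -> `|z| = 1
    & forall z, X (0, z) -> z = 1].

(** Subgroups of the integers are cyclic: Euclidean division by the least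
    positive element, or [m = 0] if there is none. *)
Lemma int_subgroup_cyclic (K : int -> Prop) : K 0 ->
  (forall m n, K m -> K n -> K (m - n)) ->
  exists m : nat, K m /\ forall n, K n -> exists k : int, n = m%:Z * k.
Proof.
move=> K0 KB; have KN n : K n -> K (- n) by move/(KB 0 n K0); rewrite sub0r.
have KD m n : K m -> K n -> K (m + n) by move=> Km /KN /(KB _ _ Km);
  rewrite opprK.
have [[n [n0 Kn]]|Kz] := pselect (exists n : nat, (0 < n)%N /\ K n); last first.
  exists 0%N; split=> // n Kn; exists 0; rewrite mulr0;
    apply: contrapT => /eqP n0.
  apply: Kz; exists `|n|%N; rewrite absz_gt0 n0; split=> //.
  by case: n Kn {n0} => // n /KN; rewrite NegzE opprK.
have exm : exists n : nat, `[< (0 < n)%N /\ K n >] by exists n; apply/asboolP.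
case: (ex_minnP exm) => m /asboolP[m0 Km] mmin; exists m; split=> // z Kz.
have KZ k : K (m%:Z * k).
  have KNat j : K (m%:Z * j%:Z).
    by elim: j => [|j ih]; rewrite ?mulr0// intS mulrDr mulr1; exact: KD.
  by case: k => // j; rewrite NegzE mulrN; exact/KN/KNat.
exists (z %/ m%:Z)%Z; rewrite {1}(divz_eq z m%:Z) mulrC.
have Kr : K (z %% m%:Z)%Z.
  rewrite (_ : (z %% m)%Z = z - m%:Z * (z %/ m)%Z); first exact: KB.
  by rewrite {2}(divz_eq z m%:Z) mulrC addrAC subrr add0r.
have r0 : (0 <= z %% m%:Z)%Z by rewrite modz_ge0// -lt0n.
have rm : ((z %% m%:Z)%Z < m%:Z) by rewrite ltz_pmod.
suff -> : (z %% m%:Z)%Z = 0 by rewrite addr0.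
case: (z %% m%:Z)%Z r0 rm Kr => // -[//|r] _;
  rewrite ltz_nat ltnNge => /negP rm Kr.
by exfalso; apply: rm; apply: mmin; apply/asboolP.
Qed.

(** A root of [1 + X + ... + X^(m-1)], which does not vanish at [1] in
    characteristic zero. *)
Lemma exists_root_neq1 m : (1 < m)%N -> exists2 c : C, c ^+ m = 1 & c != 1.
Proof.
move=> m1; pose p : {poly C} := \sum_(i < m) 'X^i.
have pE x : p.[x] = \sum_(i < m) x ^+ i.
  by rewrite /p horner_sum; apply: eq_bigr => i _; rewrite hornerXn.
have p1 : p.[1] != 0.
  rewrite pE (eq_bigr (fun=> 1)) => [|i _]; last by rewrite expr1n.
  by rewrite sumr_const card_ord pnatr_eq0 -lt0n ltnW.
have /closed_rootP[c] : size p != 1%N.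
  have -> : p = \poly_(i < m) 1.
    by rewrite poly_def; apply: eq_bigr => i _; rewrite scale1r.
  by rewrite size_poly_eq ?oner_neq0// neq_ltn m1 orbT.
rewrite /root => /eqP pc; exists c.
  by apply/eqP; rewrite -subr_eq0 subrX1 -pE pc mulr0.
by apply: contra_neq p1 => <-.
Qed.

Lemma norm_eq1_of_expr m c : (0 < m)%N -> `|c ^+ m| = 1 -> `|c| = 1.
Proof.
by move=> m0; rewrite normrX => /eqP; rewrite pexpr_eq1// ?normr_ge0// => /eqP.
Qed.

(** The last clause serves to separate an element from [0] at the very first
    extension step; for [m = 0] the value [-1] will do. *)
Lemma exists_unit_root m (z : C) : `|z| = 1 -> exists c : C,
  [/\ `|c| = 1, (0 < m)%N -> c ^+ m = z & z = 1 -> m != 1%N -> c != 1].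
Proof.
move=> z1; case: m => [|m].
  by exists (-1); rewrite normrN normr1; split=> // _ _; rewrite eqNr oner_eq0.
have [zE|zN] := eqVneq z 1; last first.
  exists (m.+1.-root z); rewrite rootCK//; split=> //; last by move/eqP: zN.
  by apply: (@norm_eq1_of_expr m.+1) => //; rewrite rootCK.
case: m => [|m]; first by exists 1; rewrite normr1 zE; split.
have [//|c cm c1] := @exists_root_neq1 m.+2.
exists c; rewrite zE; split=> //; apply: (@norm_eq1_of_expr m.+2) => //.
by rewrite cm normr1.
Qed.

Section extension.
Variable X : set (G * C).
Hypotheses (pX : partial_character X) (X0 : X (0, 1)).

Lemma pc_neq0 g z : X (g, z) -> z != 0.
Proof. by case: pX => _ h _ /h; rewrite -normr_gt0 => ->. Qed.

Lemma pc_opp g z : X (g, z) -> X (- g, z^-1).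
Proof. by case: pX => h _ _ /(h _ _ _ _ X0); rewrite sub0r div1r. Qed.

Lemma pc_add g h z w : X (g, z) -> X (h, w) -> X (g + h, z * w).
Proof.
by move=> Xg /pc_opp Xh; case: pX => /(_ _ _ _ _ Xg Xh); rewrite opprK invrK.
Qed.

Lemma pc_mulz g z (k : int) : X (g, z) -> X (g *~ k, z ^ k).
Proof.
move=> Xg; have Xn n : X (g *+ n, z ^+ n).
  by elim: n => [|n ih]; rewrite ?mulr0n ?expr0// mulrS exprS; exact: pc_add.
by case: k => n; rewrite -?pmulrn ?exprnP// NegzE mulrNz -pmulrn -invr_expz
  -exprnP; exact: pc_opp.
Qed.

Lemma pc_inj g z w : X (g, z) -> X (g, w) -> z = w.
Proof.
move=> Xz Xw; case: pX => /(_ _ _ _ _ Xz Xw) + _ h; rewrite subrr => /h /eqP.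
by rewrite -subr_eq0 -[X in _ - X](divff (pc_neq0 Xw)) -mulrBl mulf_eq0 invr_eq0
  (negPf (pc_neq0 Xw)) orbF subr_eq0 => /eqP.
Qed.

(** The integers [n] such that the character is already prescribed at [h *~ n]
    form a subgroup, generated by some [m]; the only constraint on the value
    [c] at [h] is that its [m]-th power be the value at [h *~ m]. *)
Lemma exists_extension_value h : exists c, [/\ `|c| = 1,
  forall n z, X (h *~ n, z) -> z = c ^ n
  & (forall g z, X (g, z) -> g = 0) -> h <> 0 -> c != 1].
Proof.
have K0 : exists z, X (h *~ 0, z) by exists 1; rewrite mulr0z.
have [|m [[z Xz] mK]] := @int_subgroup_cyclic (fun n => exists z, X (h *~ n, z))
  K0.
  move=> m n [z Xz] [w Xw]; exists (z / w); rewrite mulrzBr.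
  by case: pX => + _ _; apply.
have z1 : `|z| = 1 by case: pX => _ + _; apply; exact: Xz.
have [c [c1 cm cN]] := exists_unit_root m z1; exists c; split=> //.
  move=> n w Xw; have [k nE] : exists k : int, n = m%:Z * k by apply: mK;
    exists w.
  have c0 : c != 0 by rewrite -normr_gt0 c1.
  have [m0|m0] := posnP m.
    by move: Xw; rewrite nE m0 mul0r mulr0z => Xw; rewrite expr0z;
      exact: (pc_inj Xw X0).
  apply: pc_inj Xw _; rewrite nE -exprz_exp -exprnP cm// mulrzA.
  exact: pc_mulz.
move=> triv h0; apply: cN.
  by have zX := triv _ _ Xz; rewrite zX in Xz; case: pX => _ _; apply.
by apply/eqP => m1; apply: h0; have := triv _ _ Xz; rewrite m1.
Qed.

Lemma norm1_exprz c (n : int) : `|c| = 1 -> `|c ^ n| = 1.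
Proof.
by move=> c1; case: n => n;
  rewrite ?NegzE -?invr_expz ?normfV -exprnP normrX c1 expr1n ?invr1.
Qed.

Lemma partial_character_extend h c : `|c| = 1 ->
  (forall n z, X (h *~ n, z) -> z = c ^ n) ->
  partial_character [set p | exists g z (n : int),
    X (g, z) /\ p = (g + h *~ n, z * c ^ n)].
Proof.
move=> c1 hc; have c0 : c != 0 by rewrite -normr_gt0 c1.
case: (pX) => pB pn p0; split.
- move=> _ _ _ _ [g [z [n [Xg [-> ->]]]]] [g' [w [m [Xg' [-> ->]]]]].
  exists (g - g'), (z / w), (n - m); split; first exact: pB.
  rewrite mulrzBr opprD addrACA; congr (_, _).
  by rewrite expfzDr// -invr_expz invfM mulrACA.
- move=> _ _ [g [z [n [Xg [_ ->]]]]].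
  by rewrite normrM (pn _ _ Xg) mul1r norm1_exprz.
- move=> w [g [z [n [Xg [g0 ->]]]]].
  have gE : g = h *~ (- n) by apply/eqP; rewrite mulrNz -addr_eq0 -g0.
  by rewrite gE in Xg; rewrite (hc _ _ Xg) -expfzDr// addNr expr0z.
Qed.

End extension.

(** Start from the subgroup generated by [g0], with a value different from [1]
    at [g0], and take a maximal extension; it is defined everywhere, since
    otherwise it could be extended further. *)
Lemma exists_character_neq1 g0 : g0 <> 0 -> exists x : dual R G, x g0 != 1.
Proof.
move=> g00; pose X0 : set (G * C) := [set (0, 1)].
have pX0 : partial_character X0.
  split=> [g h z w [-> ->] [-> ->]|g z [_ ->]|z [->//]].
    by rewrite subrr divr1.
  by rewrite normr1.
have [c [c1 hc cN]] := exists_extension_value pX0 (erefl _) g0.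
have {}cN : c != 1 by apply: cN => // g z [->].
pose X1 := [set p | exists g z (n : int), X0 (g, z) /\
  p = (g + g0 *~ n, z * c ^ n)].
have pX1 : partial_character X1 by exact: partial_character_extend.
have X1g : X1 (g0, c) by exists 0, 1, 1; rewrite add0r mulr1z mul1r expr1z.
(* The base point is required of nonempty sets only, because the union of the
   empty chain is empty. *)
have [] := @Zorn_bigcup _ [set X | partial_character X /\
  (X !=set0 -> X (g0, c))].
  move=> F FP tot; split; last first.
    by move=> [p [X FX Xp]]; exists X => //; apply: (FP _ FX).2; exists p.
  split.
  - move=> g h z w [X FX Xg] [Y FY Yh].
    have [XY|YX] := tot _ _ FX FY.
      by exists Y => //; have [[+ _ _] _] := FP _ FY; apply=> //; exact: XY.
    by exists X => //; have [[+ _ _] _] := FP _ FX; apply=> //; exact: YX.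
  - by move=> g z [X FX Xg]; have [[_ + _] _] := FP _ FX; apply; exact: Xg.
  - by move=> z [X FX Xg]; have [[_ _ +] _] := FP _ FX; apply.
move=> A [[pA Ag] Amax].
have {}Ag : A (g0, c).
  apply: Ag; apply: contrapT => /set0P/negP; rewrite negbK => /eqP A0.
  apply: (Amax X1); last by split.
  by rewrite A0; split=> [//|/(_ _ X1g)].
have A0 : A (0, 1).
  have [pB pn _] := pA; have := pB _ _ _ _ Ag Ag.
  by rewrite subrr divff// -normr_gt0 c1.
have tot h : exists z, A (h, z).
  have [e [e1 he _]] := exists_extension_value pA A0 h.
  exists e; apply: contrapT => nA.
  apply: (Amax [set p | exists g z (n : int), A (g, z) /\
    p = (g + h *~ n, z * e ^ n)]).
    split; last first.
      move=> /(_ (h, e)) H; apply: nA; apply: H; exists 0, 1, 1.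
      by rewrite add0r mulr1z mul1r expr1z.
    by move=> [g z] Ag'; exists g, z, 0; rewrite mulr0z addr0 expr0z mulr1.
  split; first exact: partial_character_extend.
  by move=> _; exists g0, c, 0; rewrite mulr0z addr0 expr0z mulr1.
pose f h := sval (cid (tot h)).
have Af h : A (h, f h) := svalP (cid (tot h)).
have cf : is_character f.
  split=> [g|g h]; first by have [_ + _] := pA; apply; exact: Af.
  exact: (pc_inj pA (Af _) (pc_add pA A0 (Af g) (Af h))).
by exists (Dual cf); rewrite /= (pc_inj pA (Af g0) Ag).
Qed.

End characters.

Local Open Scope sesquilinear_scope.

(** * Adjoints and positive definite forms *)

Section adjoint.
Variable R : realType.
Local Notation C := (R[i]).

Lemma ReD (z w : C) : complex.Re (z + w) = complex.Re z + complex.Re w.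
Proof. by case: z w => a b []. Qed.
Lemma ImD (z w : C) : complex.Im (z + w) = complex.Im z + complex.Im w.
Proof. by case: z w => a b []. Qed.
Lemma ReM (z w : C) : complex.Re (z * w) =
  complex.Re z * complex.Re w - complex.Im z * complex.Im w.
Proof. by case: z w => a b []. Qed.
Lemma ImM (z w : C) : complex.Im (z * w) =
  complex.Re z * complex.Im w + complex.Im z * complex.Re w.
Proof. by case: z w => a b [] c d; rewrite /=. Qed.
Lemma ReN (z : C) : complex.Re (- z) = - complex.Re z.
Proof. by case: z. Qed.
Lemma ImN (z : C) : complex.Im (- z) = - complex.Im z.
Proof. by case: z. Qed.
Lemma ReJ (z : C) : complex.Re (z^*)%R = complex.Re z.
Proof. by case: z => a b. Qed.
Lemma ImJ (z : C) : complex.Im (z^*)%R = - complex.Im z.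
Proof. by case: z => a b. Qed.
Lemma Re_ge0 (z : C) : 0 <= z -> 0 <= complex.Re z.
Proof. by rewrite lecE => /andP[]. Qed.
Lemma ge0_Re_eq0 (z : C) : 0 <= z -> complex.Re z = 0 -> z = 0.
Proof. by case: z => a b; rewrite lecE /= => /andP[/eqP-> _] ->. Qed.
Lemma eq_ReIm (z w : C) :
  complex.Re z = complex.Re w -> complex.Im z = complex.Im w -> z = w.
Proof. by case: z w => a b [c d] /= -> ->. Qed.
Lemma ReZ (r : R) (z : C) : complex.Re (r%:C * z) = r * complex.Re z.
Proof. by rewrite ReM /= mul0r subr0. Qed.

Section mx.
Context {m n p : nat}.
Implicit Types A : 'M[C]_(m, n).

Lemma adjD A B : (A + B)^t* = A^t* + B^t*.
Proof. by apply/matrixP => i j; rewrite !mxE rmorphD. Qed.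
Lemma adjN A : (- A)^t* = - A^t*.
Proof. by apply/matrixP => i j; rewrite !mxE rmorphN. Qed.
Lemma adjB A B : (A - B)^t* = A^t* - B^t*.
Proof. by rewrite adjD adjN. Qed.
Lemma adjM A (B : 'M[C]_(n, p)) : (A *m B)^t* = B^t* *m A^t*.
Proof. by rewrite trmx_mul map_mxM. Qed.
Lemma adjZ c A : (c *: A)^t* = (c^*)%R *: A^t*.
Proof. by apply/matrixP => i j; rewrite !mxE rmorphM. Qed.
Lemma adj0 : (0 : 'M[C]_(m, n))^t* = 0.
Proof. by apply/matrixP => i j; rewrite !mxE rmorph0. Qed.
End mx.
Lemma adj1 n : (1%:M : 'M[C]_n)^t* = 1%:M.
Proof. by apply/matrixP => i j; rewrite !mxE rmorph_nat eq_sym. Qed.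

Context {q : nat}.
Implicit Types (A B W : 'M[C]_q).

Lemma ntrD A B : ntr (A + B) = ntr A + ntr B.
Proof. by rewrite /ntr mxtraceD mulrDl. Qed.
Lemma ntrN A : ntr (- A) = - ntr A.
Proof. by rewrite /ntr raddfN mulNr. Qed.
Lemma ntrZ c A : ntr (c *: A) = c * ntr A.
Proof. by rewrite /ntr mxtraceZ mulrA. Qed.
Lemma ntr0 : ntr (0 : 'M[C]_q) = 0.
Proof. by rewrite /ntr mxtrace0 mul0r. Qed.
Lemma ntr_adj A : ntr (A^t*) = (ntr A)^*%R.
Proof.
rewrite /ntr rmorphM /= fmorphV rmorph_nat /mxtrace rmorph_sum.
by congr (_ / _); apply: eq_bigr => i _; rewrite !mxE.
Qed.

(** The real part of the normalized trace form: a real inner product on the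
    matrices when [W] is positive definite, which lets norm estimates be made
    over [R]. *)
Definition pdot W A B : R := complex.Re (ntr (A *m W *m B^t*)).

Lemma pdotDl W A A' B : pdot W (A + A') B = pdot W A B + pdot W A' B.
Proof. by rewrite /pdot !mulmxDl ntrD ReD. Qed.
Lemma pdotZl W r A B : pdot W (r%:C *: A) B = r * pdot W A B.
Proof. by rewrite /pdot -!scalemxAl ntrZ ReZ. Qed.
Lemma pdotNl W A B : pdot W (- A) B = - pdot W A B.
Proof. by rewrite /pdot !mulNmx ntrN ReN. Qed.

Section posdef.
Variable W : 'M[C]_q.
Hypothesis Wpos : posdefmx W.

Lemma posdef_adj : W^t* = W.
Proof. by case: Wpos => /is_hermitianmxP; rewrite expr0 scale1r => <-. Qed.

Lemma adj_sandwich A B : (A *m W *m B^t*)^t* = B *m W *m A^t*.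
Proof. by rewrite !adjM trmxCK posdef_adj mulmxA. Qed.

Lemma posdef_unit : W \in unitmx.
Proof.
rewrite -row_free_unit -kermx_eq0; apply/eqP/row_matrixP => i; rewrite row0.
apply/eqP/negP => /negP v0; have [_ /(_ _ v0)] := Wpos.
have -> : row i (kermx W) *m W = 0 by apply/sub_kermxP; exact: row_sub.
by rewrite mul0mx mxE ltxx.
Qed.

Lemma diag_sandwich A i : (A *m W *m A^t*) i i =
  (row i A *m W *m (row i A)^t*) 0 0.
Proof.
rewrite -row_mul !mxE; apply: eq_bigr => k _; by congr (_ * _); rewrite !mxE.
Qed.

Lemma diag_sandwich_ge0 A i : 0 <= (A *m W *m A^t*) i i.
Proof.
rewrite diag_sandwich; have [->|v0] := eqVneq (row i A) 0.
  by rewrite !mul0mx mxE.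
by have [_ /(_ _ v0)/ltW] := Wpos.
Qed.

Lemma ntr_sandwich_ge0 A : 0 <= ntr (A *m W *m A^t*).
Proof.
rewrite /ntr mulr_ge0 ?invr_ge0 ?ler0n//.
by apply: sumr_ge0 => i _; exact: diag_sandwich_ge0.
Qed.

Lemma pdot_ge0 A : 0 <= pdot W A A.
Proof. exact/Re_ge0/ntr_sandwich_ge0. Qed.

Lemma pdot_eq0 A : pdot W A A = 0 -> A = 0.
Proof.
move=> /(ge0_Re_eq0 (ntr_sandwich_ge0 A)) /eqP; rewrite /ntr mulf_eq0.
rewrite psumr_eq0 => [H|i _]; last exact: diag_sandwich_ge0.
apply/row_matrixP => i; rewrite row0; apply/eqP/negP => /negP v0.
case/orP: H => [/allP/(_ i)|]; last first.
  rewrite invr_eq0 pnatr_eq0 => /eqP q0; have := ltn_ord i.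
  by rewrite [X in (_ < X)%N]q0 ltn0.
rewrite mem_index_enum => /(_ isT); rewrite diag_sandwich => /eqP h.
by have [_ /(_ _ v0)] := Wpos; rewrite h ltxx.
Qed.

Lemma pdotC A B : pdot W A B = pdot W B A.
Proof. by rewrite /pdot -adj_sandwich ntr_adj ReJ. Qed.

(** Nonnegativity of the form at [A + B] and [A - B]. *)
Lemma pdot_le A B : `|pdot W A B| <= pdot W A A + pdot W B B.
Proof.
have := pdot_ge0 (A + B); have := pdot_ge0 (A - B).
rewrite !(pdotDl, pdotNl) !(pdotC _ (A + _)) !(pdotDl, pdotNl) (pdotC B A).
have := pdot_ge0 A; have := pdot_ge0 B; move: (pdot W A B) => c.
rewrite ler_norml; lra.
Qed.

Lemma tr_delta_mul i j (M : 'M[C]_q) : \tr (delta_mx j i *m M) = M i j.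
Proof.
rewrite /mxtrace (bigD1 j)//= big1 ?addr0 => [|k kj].
  rewrite mxE (bigD1 i)//= big1 ?addr0 => [|l li]; rewrite mxE ?eqxx ?mul1r//.
  by rewrite (negPf li) andbF mul0r.
by rewrite mxE big1// => l _; rewrite mxE (negPf kj) mul0r.
Qed.

(** Up to a unimodular factor, [delta_mx j i *m A] has row [i] of [A] as its
    only nonzero row, so its square is one of the nonnegative terms that add
    up to the square of [A]. *)
Lemma pdot_delta (c : C) i j A : c * c^*%R = 1 ->
  pdot W (c *: (delta_mx j i *m A)) (c *: (delta_mx j i *m A)) <= pdot W A A.
Proof.
move=> c1; rewrite /pdot adjZ -!scalemxAl -scalemxAr scalerA c1 scale1r.
rewrite adjM !mulmxA -(mulmxA (delta_mx j i)) -(mulmxA (delta_mx j i)).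
set M := A *m W *m _.
have -> : (delta_mx j i : 'M[C]_q)^t* = delta_mx i j.
  by apply/matrixP => a b; rewrite !mxE rmorph_nat andbC.
rewrite /ntr mxtrace_mulC mulmxA mul_delta_mx -subr_ge0 -ReN -ReD.
rewrite -mulNr -mulrDl; apply: Re_ge0; rewrite mulr_ge0 ?invr_ge0 ?ler0n//.
rewrite tr_delta_mul.
rewrite /mxtrace (bigD1 i)//= addrAC subrr add0r.
by apply: sumr_ge0 => k _; exact: diag_sandwich_ge0.
Qed.

(** The entry at [i], [j] is a trace, hence a value of the form, once a matrix
    unit has been absorbed into [A]. The factor [c] gives access to both the
    real and the imaginary part. *)
Lemma entry_le A B i j (c : C) : c * c^*%R = 1 ->
  `|complex.Re (c * (A *m W *m B^t*) i j)| <= q%:R * (pdot W A A + pdot W B B).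
Proof.
move=> c1; have q0 : (0 < q)%N by case: q i => // -[].
have -> : complex.Re (c * (A *m W *m B^t*) i j) =
    q%:R * pdot W (c *: (delta_mx j i *m A)) B.
  rewrite /pdot -!scalemxAl ntrZ -!mulmxA /ntr tr_delta_mul mulrA.
  rewrite [c * _ / _]mulrC.
  have -> : (q%:R : C)^-1 = (q%:R^-1 : R)%:C by rewrite fmorphV rmorph_nat.
  by rewrite ReZ mulVKf ?pnatr_eq0 -?lt0n.
rewrite normrM ger0_norm ?ler0n// ler_wpM2l ?ler0n//.
by apply: (le_trans (pdot_le _ _)); rewrite lerD2r pdot_delta.
Qed.

Lemma Re_entry_le A B i j : `|complex.Re ((A *m W *m B^t*) i j)| <=
  q%:R * (pdot W A A + pdot W B B).
Proof. by rewrite -[X in complex.Re X]mul1r entry_le// rmorph1 mulr1. Qed.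

Lemma Im_entry_le A B i j : `|complex.Im ((A *m W *m B^t*) i j)| <=
  q%:R * (pdot W A A + pdot W B B).
Proof.
rewrite -normrN -ReiNIm [_ * 'i%C]mulrC; apply: entry_le.
by apply: eq_ReIm; rewrite /= ?mul0r ?mulr0 ?mul1r ?opprK ?add0r ?addr0 ?subr0.
Qed.

Lemma posdef_inv : posdefmx (invmx W).
Proof.
have Wadj : (invmx W)^t* = invmx W.
  have /(congr1 (fun M => M^t* *m invmx W)) := mulmxV posdef_unit.
  rewrite adjM posdef_adj adj1 mul1mx -mulmxA mulmxV ?mulmx1//.
  exact: posdef_unit.
split; first by apply/is_hermitianmxP; rewrite expr0 scale1r Wadj.
move=> v v0; have [_ /(_ (v *m invmx W))] := Wpos.
rewrite adjM Wadj !mulmxA mulmxKV ?posdef_unit//; apply.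
apply: contra v0 => /eqP /(congr1 (mulmx^~ W)).
by rewrite mulmxKV ?posdef_unit// mul0mx => ->.
Qed.
End posdef.
End adjoint.

(** * Integration of complex and of matrix-valued functions *)

Section realint.
Context d (T : measurableType d) (R : realType).
Variable mu : {measure set T -> \bar R}.
Implicit Types f g h : T -> R.
Local Notation rint f := (mu.-integrable setT (fun x => (f x)%:E)).

Lemma rint_measurable f : rint f -> measurable_fun setT f.
Proof. by move=> /integrableP[/measurable_EFinP]. Qed.

Lemma rintD f g : rint f -> rint g -> rint (fun x => f x + g x).
Proof. by move=> hf hg; exact: (integrableD measurableT hf hg). Qed.

Lemma rintZ r f : rint f -> rint (fun x => r * f x).
Proof. by move=> hf; exact: (integrableZl measurableT r hf). Qed.

Lemma rintN f : rint f -> rint (fun x => - f x).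
Proof.
by move=> /(rintZ (-1)); under eq_fun do rewrite mulN1r.
Qed.

(** The bounds on forms hold only where the weight is positive definite, so
    that domination is available only almost everywhere. *)
Lemma rint_le_ae f g : measurable_fun setT f -> rint g ->
  {ae mu, forall x, `|f x| <= g x} -> rint f.
Proof.
move=> mf /integrableP[mg goo] fg; apply/integrableP; split.
  exact/measurable_EFinP.
apply: le_lt_trans goo; apply: ae_ge0_le_integral => //.
- by apply: measurableT_comp => //; exact/measurable_EFinP.
- exact: measurableT_comp.
- apply: filterS fg => x fg _; rewrite lee_fin.
  exact: (le_trans fg (ler_norm _)).
Qed.

Lemma eq_ae_Rintegral f g : measurable_fun setT f -> measurable_fun setT g ->
  {ae mu, forall x, f x = g x} -> \int[mu]_x f x = \int[mu]_x g x.
Proof.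
move=> mf mg fg; congr fine; apply: ae_eq_integral => //.
- exact/measurable_EFinP.
- exact/measurable_EFinP.
- by apply: filterS fg => x -> _.
Qed.

Lemma ae_Rintegral_ge0 f : measurable_fun setT f ->
  {ae mu, forall x, 0 <= f x} -> 0 <= \int[mu]_x f x.
Proof.
move=> mf f0; rewrite (@eq_ae_Rintegral _ (fun x => `|f x|))//.
- exact: Rintegral_ge0.
- exact: measurableT_comp.
- by apply: filterS f0 => x /ger0_norm.
Qed.

Lemma ae_Rintegral_eq0 f : rint f ->
  {ae mu, forall x, 0 <= f x} -> \int[mu]_x f x = 0 ->
  {ae mu, forall x, f x = 0}.
Proof.
move=> hf f0; have mf := rint_measurable hf.
rewrite (@eq_ae_Rintegral _ (fun x => `|f x|))//; last 2 first.
- exact: measurableT_comp.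
- by apply: filterS f0 => x /ger0_norm.
move=> i0; have : (\int[mu]_x `|(f x)%:E| = 0)%E.
  rewrite -[LHS]fineK; first by congr (_%:E).
  by rewrite ge0_fin_numE ?integral_ge0//; case/integrableP: hf.
move/ae_eq_integral_abs => /(_ measurableT) h.
have {}h := h ((measurable_EFinP _ _).2 mf).
by apply: filterS h => x /(_ I)[].
Qed.

Lemma integral_EFin_Rintegral f : rint f ->
  (\int[mu]_x (f x)%:E = (\int[mu]_x f x)%:E)%E.
Proof. by move=> hf; rewrite fineK//; exact: integrable_fin_num. Qed.

Lemma rint_norm f : rint f -> rint (fun x => `|f x|).
Proof. by move=> hf; exact: (integrable_norm hf). Qed.

Lemma ae_le_Rintegral f g : rint f -> rint g ->
  {ae mu, forall x, f x <= g x} -> \int[mu]_x f x <= \int[mu]_x g x.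
Proof.
move=> hf hg fg; rewrite -subr_ge0 -RintegralB//; apply: ae_Rintegral_ge0.
  by apply: measurable_funB;
    [exact: rint_measurable hg|exact: rint_measurable hf].
by apply: filterS fg => x; rewrite subr_ge0.
Qed.

End realint.

Section complexint.
Context d (T : measurableType d) (R : realType).
Variable mu : {measure set T -> \bar R}.
Local Notation C := (R[i]).
Implicit Types f g : T -> C.

Lemma cmeasurable_cst (c : C) : cmeasurable (fun _ : T => c).
Proof. by split; exact: measurable_cst. Qed.

Lemma cmeasurableD f g : cmeasurable f -> cmeasurable g ->
  cmeasurable (fun x => f x + g x).
Proof.
move=> [f1 f2] [g1 g2]; split.
  by under eq_fun do rewrite ReD; exact: measurable_funD.
by under eq_fun do rewrite ImD; exact: measurable_funD.
Qed.

Lemma cmeasurableM f g : cmeasurable f -> cmeasurable g ->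
  cmeasurable (fun x => f x * g x).
Proof.
move=> [f1 f2] [g1 g2]; split.
  by under eq_fun do rewrite ReM; apply: measurable_funB;
    exact: measurable_funM.
by under eq_fun do rewrite ImM; apply: measurable_funD; exact: measurable_funM.
Qed.

Lemma cmeasurableJ f : cmeasurable f -> cmeasurable (fun x => (f x)^*%R).
Proof.
move=> [f1 f2]; split.
  by under eq_fun do rewrite ReJ.
by under eq_fun do rewrite ImJ; exact: measurable_funN.
Qed.

Lemma cmeasurable_sum I (s : seq I) (f : I -> T -> C) :
  (forall i, cmeasurable (f i)) -> cmeasurable (fun x => \sum_(i <- s) f i x).
Proof.
move=> mf; elim: s => [|i s ih].
  by under eq_fun do rewrite big_nil; exact: cmeasurable_cst.
by under eq_fun do rewrite big_cons; exact: cmeasurableD.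
Qed.

Lemma cintegrable_cmeasurable f : cintegrable mu f -> cmeasurable f.
Proof. by move=> [f1 f2]; split;
  [exact: rint_measurable f1|exact: rint_measurable f2]. Qed.

Lemma cintegrable_le f (g : T -> R) : cmeasurable f ->
  mu.-integrable setT (fun x => (g x)%:E) ->
  {ae mu, forall x, `|complex.Re (f x)| <= g x} ->
  {ae mu, forall x, `|complex.Im (f x)| <= g x} -> cintegrable mu f.
Proof. by move=> [f1 f2] ig h1 h2; split; exact: rint_le_ae ig _. Qed.

Lemma cintegrable0 : cintegrable mu (fun=> 0).
Proof. by split; exact: integrable0. Qed.

Lemma cintegrableD f g : cintegrable mu f -> cintegrable mu g ->
  cintegrable mu (fun x => f x + g x).
Proof.
move=> [f1 f2] [g1 g2]; split.
  by under eq_fun do rewrite ReD; exact: rintD.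
by under eq_fun do rewrite ImD; exact: rintD.
Qed.

Lemma cintegrableZ c f : cintegrable mu f -> cintegrable mu (fun x => c * f x).
Proof.
move=> [f1 f2]; split.
  under eq_fun do rewrite ReM.
  by apply: rintD; [|apply: rintN]; exact: rintZ.
by under eq_fun do rewrite ImM; apply: rintD; exact: rintZ.
Qed.

Lemma cintegrableJ f : cintegrable mu f -> cintegrable mu (fun x => (f x)^*%R).
Proof.
move=> [f1 f2]; split.
  by under eq_fun do rewrite ReJ.
by under eq_fun do rewrite ImJ; exact: rintN.
Qed.

Lemma cintegrable_sum I (s : seq I) (f : I -> T -> C) :
  (forall i, cintegrable mu (f i)) ->
  cintegrable mu (fun x => \sum_(i <- s) f i x).
Proof.
move=> mf; elim: s => [|i s ih].
  by under eq_fun do rewrite big_nil; exact: cintegrable0.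
by under eq_fun do rewrite big_cons; exact: cintegrableD.
Qed.

Lemma eq_ae_cintegral f g : cmeasurable f -> cmeasurable g ->
  {ae mu, forall x, f x = g x} -> cintegral mu f = cintegral mu g.
Proof.
move=> [f1 f2] [g1 g2] fg; rewrite /cintegral; congr (_ +i* _);
  by apply: eq_ae_Rintegral => //; apply: filterS fg => x ->.
Qed.

Lemma cintegralD f g : cintegrable mu f -> cintegrable mu g ->
  cintegral mu (fun x => f x + g x) = cintegral mu f + cintegral mu g.
Proof.
move=> [f1 f2] [g1 g2]; apply: eq_ReIm; rewrite ?ReD ?ImD /=.
  by rewrite -RintegralD//; apply: eq_Rintegral => x _; rewrite ReD.
by rewrite -RintegralD//; apply: eq_Rintegral => x _; rewrite ImD.
Qed.

Lemma cintegralZ c f : cintegrable mu f ->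
  cintegral mu (fun x => c * f x) = c * cintegral mu f.
Proof.
move=> [f1 f2]; apply: eq_ReIm; rewrite ?ReM ?ImM /=.
  rewrite -!RintegralZl// -RintegralB//; [|exact: rintZ..].
  by apply: eq_Rintegral => x _; rewrite ReM.
rewrite -!RintegralZl// -RintegralD//; [|exact: rintZ..].
by apply: eq_Rintegral => x _; rewrite ImM.
Qed.

Lemma cintegralJ f : cintegrable mu f ->
  cintegral mu (fun x => (f x)^*%R) = (cintegral mu f)^*%R.
Proof.
move=> [f1 f2]; apply: eq_ReIm; rewrite ?ReJ ?ImJ /=.
  by apply: eq_Rintegral => x _; rewrite ReJ.
rewrite -mulN1r -RintegralZl//.
by apply: eq_Rintegral => x _; rewrite ImJ mulN1r.
Qed.

Lemma cintegral0 : cintegral mu (fun=> 0) = 0.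
Proof.
rewrite -[LHS](_ : cintegral mu (fun=> 0 * 0) = _).
  by rewrite cintegralZ ?mul0r//; exact: cintegrable0.
by congr cintegral; apply/funext => x; rewrite mul0r.
Qed.

Lemma cintegral_sum I (s : seq I) (f : I -> T -> C) :
  (forall i, cintegrable mu (f i)) ->
  cintegral mu (fun x => \sum_(i <- s) f i x) = \sum_(i <- s) cintegral mu
    (f i).
Proof.
move=> mf; elim: s => [|i s ih].
  by under eq_fun do rewrite big_nil; rewrite big_nil cintegral0.
under eq_fun do rewrite big_cons.
by rewrite cintegralD ?ih ?big_cons//; exact: cintegrable_sum.
Qed.

Lemma eq_ae_cintegrable f g : cmeasurable f -> cintegrable mu g ->
  {ae mu, forall x, f x = g x} -> cintegrable mu f.
Proof.
move=> [mf1 mf2] [ig1 ig2] fg; split.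
  apply: rint_le_ae (rint_norm ig1) _ => //.
  by apply: filterS fg => x ->.
apply: rint_le_ae (rint_norm ig2) _ => //.
by apply: filterS fg => x ->.
Qed.

End complexint.

Section mxint.
Context d (T : measurableType d) (R : realType) (q : nat).
Variable mu : {measure set T -> \bar R}.
Local Notation C := (R[i]).
Implicit Types F H : T -> 'M[C]_q.
Implicit Types A B : 'M[C]_q.

Lemma mxmeasurable_cst A : mxmeasurable (fun _ : T => A).
Proof. by move=> i j; exact: cmeasurable_cst. Qed.

Lemma mxmeasurableD F H : mxmeasurable F -> mxmeasurable H ->
  mxmeasurable (F \+ H).
Proof.
by move=> mF mH i j; under eq_fun do rewrite mxE; exact: cmeasurableD.
Qed.

Lemma mxmeasurableM F H : mxmeasurable F -> mxmeasurable H ->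
  mxmeasurable (fun x => F x *m H x).
Proof.
move=> mF mH i j; under eq_fun do rewrite mxE.
by apply: cmeasurable_sum => k; exact: cmeasurableM.
Qed.

Lemma mxmeasurable_adj F : mxmeasurable F -> mxmeasurable (fun x => (F x)^t*).
Proof. by move=> mF i j; under eq_fun do rewrite !mxE; exact: cmeasurableJ. Qed.

Lemma cmeasurable_ntr F : mxmeasurable F -> cmeasurable (fun x => ntr (F x)).
Proof.
move=> mF; apply: cmeasurableM; last exact: cmeasurable_cst.
exact: cmeasurable_sum.
Qed.

Lemma mxintegrable_measurable F : mxintegrable mu F -> mxmeasurable F.
Proof. by move=> iF i j; exact: cintegrable_cmeasurable. Qed.

Lemma mxintegrableD F H : mxintegrable mu F -> mxintegrable mu H ->
  mxintegrable mu (F \+ H).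
Proof.
by move=> mF mH i j; under eq_fun do rewrite mxE; exact: cintegrableD.
Qed.

Lemma mxintegrableMl A F : mxintegrable mu F ->
  mxintegrable mu (fun x => A *m F x).
Proof.
move=> mF i j; under eq_fun do rewrite mxE.
by apply: cintegrable_sum => k; exact: cintegrableZ.
Qed.

Lemma mxintegrable_adj F : mxintegrable mu F ->
  mxintegrable mu (fun x => (F x)^t*).
Proof. by move=> mF i j; under eq_fun do rewrite !mxE; exact: cintegrableJ. Qed.

Lemma mxintegrableMr A F : mxintegrable mu F ->
  mxintegrable mu (fun x => F x *m A).
Proof.
move=> /mxintegrable_adj/(mxintegrableMl (A^t*))/mxintegrable_adj.
by under eq_fun do rewrite adjM !trmxCK.
Qed.

Lemma cintegrable_ntr F : mxintegrable mu F ->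
  cintegrable mu (fun x => ntr (F x)).
Proof.
move=> mF; under eq_fun do rewrite /ntr mulrC.
exact/cintegrableZ/cintegrable_sum.
Qed.

Lemma eq_ae_mxintegral F H : mxmeasurable F -> mxmeasurable H ->
  {ae mu, forall x, F x = H x} -> mxintegral mu F = mxintegral mu H.
Proof.
move=> mF mH FH; apply/matrixP => i j; rewrite !mxE.
by apply: eq_ae_cintegral => //; apply: filterS FH => x ->.
Qed.

Lemma mxintegralD F H : mxintegrable mu F -> mxintegrable mu H ->
  mxintegral mu (F \+ H) = mxintegral mu F + mxintegral mu H.
Proof.
move=> mF mH; apply/matrixP => i j; rewrite !mxE -cintegralD//.
by under eq_fun do rewrite mxE.
Qed.

Lemma mxintegralMl A F : mxintegrable mu F ->
  mxintegral mu (fun x => A *m F x) = A *m mxintegral mu F.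
Proof.
move=> mF; apply/matrixP => i j; rewrite !mxE; under eq_fun do rewrite mxE.
rewrite cintegral_sum => [|k]; last exact: cintegrableZ.
by apply: eq_bigr => k _; rewrite cintegralZ// mxE.
Qed.

Lemma mxintegral_adj F : mxintegrable mu F ->
  mxintegral mu (fun x => (F x)^t*) = (mxintegral mu F)^t*.
Proof.
move=> mF; apply/matrixP => i j; rewrite !mxE -cintegralJ//.
by under eq_fun do rewrite !mxE.
Qed.

Lemma ntr_mxintegral F : mxintegrable mu F ->
  ntr (mxintegral mu F) = cintegral mu (fun x => ntr (F x)).
Proof.
move=> mF; rewrite /ntr mulrC; under [in RHS]eq_fun do rewrite mulrC.
rewrite cintegralZ; last exact: cintegrable_sum.
by rewrite cintegral_sum//; congr (_ * _); apply: eq_bigr => i _; rewrite mxE.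
Qed.

Lemma eq_ae_mxintegrable F H :
  mxmeasurable F -> mxintegrable mu H ->
  {ae mu, forall x, F x = H x} -> mxintegrable mu F.
Proof.
move=> mF iH FH i j; apply: (eq_ae_cintegrable (mF i j) (iH i j)).
by apply: filterS FH => x ->.
Qed.

End mxint.

(** * The inner product of a weighted L2 module *)

Section disc.
Variable R : realFieldType.
(** For [c = 0] the polynomial is affine, which forces [b = 0]. *)
Lemma quadratic_disc_le (a b c : R) :
  0 <= c -> (forall t, 0 <= a + 2 * t * b + t ^+ 2 * c) -> b ^+ 2 <= a * c.
Proof.
(* for [c > 0], evaluate at the minimum [- b / c] *)
rewrite le_eqVlt => /predU1P[c0|c0] h; last first.
- have := h (- b / c).
  have -> : a + 2 * (- b / c) * b + (- b / c) ^+ 2 * c = (a * c - b ^+ 2) / c.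
    by field; rewrite gt_eqF.
  by rewrite ler_pdivlMr// mul0r subr_ge0.
- rewrite -c0 mulr0; have [->|b0] := eqVneq b 0; first by rewrite expr0n.
  (* when [c = 0], the polynomial takes the value [-1] here *)
  have := h (- (a + 1) / (2 * b)); rewrite -c0.
  have -> : a + 2 * (- (a + 1) / (2 * b)) * b + (- (a + 1) / (2 * b)) ^+ 2 * 0 =
    -1.
    by field.
  by lra.
Qed.
End disc.

Section L2theory.
Context d (T : measurableType d) (R : realType) (q : nat).
Variable mu : {measure set T -> \bar R}.
Local Notation C := (R[i]).
Variable V : T -> 'M[C]_q.
Hypothesis hV : weight mu V.
Implicit Types F H K : T -> 'M[C]_q.
Implicit Types A B : 'M[C]_q.
Local Notation L2V := (L2 mu V).
Local Notation ip := (mxip mu V).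
Local Notation lmul A F := (fun x => A *m F x).

Let mV : mxmeasurable V := mxintegrable_measurable hV.1.
Let pV : {ae mu, forall x, posdefmx (V x)} := hV.2.

Lemma mxmeasurable_sandwich F H : mxmeasurable F -> mxmeasurable H ->
  mxmeasurable (fun x => F x *m V x *m (H x)^t*).
Proof.
move=> mF mH; apply: mxmeasurableM; last exact: mxmeasurable_adj.
exact: mxmeasurableM.
Qed.

Lemma L2_pdot F : L2V F ->
  mu.-integrable setT (fun x => (pdot (V x) (F x) (F x))%:E).
Proof. by move=> [_ []]. Qed.

(** Each entry is dominated by the two square forms, whose integrals are finite
    for elements of the module. *)
Lemma L2_sandwich F H : L2V F -> L2V H ->
  mxintegrable mu (fun x => F x *m V x *m (H x)^t*).
Proof.
move=> lF lH i j.
apply: (@cintegrable_le _ _ _ _ _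
  (fun x => q%:R * (pdot (V x) (F x) (F x) + pdot (V x) (H x) (H x)))).
- by apply: mxmeasurable_sandwich; [case: lF|case: lH].
- by apply/rintZ/rintD; exact: L2_pdot.
- by apply: filterS pV => x Vx; exact: Re_entry_le.
- by apply: filterS pV => x Vx; exact: Im_entry_le.
Qed.

Lemma sandwich_L2 F : mxmeasurable F ->
  mxintegrable mu (fun x => F x *m V x *m (F x)^t*) -> L2V F.
Proof. by move=> mF iF; split=> //; exact: cintegrable_ntr. Qed.

Lemma pdot_L2 F : mxmeasurable F ->
  mu.-integrable setT (fun x => (pdot (V x) (F x) (F x))%:E) -> L2V F.
Proof.
move=> mF iF; apply: sandwich_L2 => // i j.
apply: (@cintegrable_le _ _ _ _ _
  (fun x => q%:R * (pdot (V x) (F x) (F x) + pdot (V x) (F x) (F x)))).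
- exact: mxmeasurable_sandwich.
- exact/rintZ/rintD.
- by apply: filterS pV => x Vx; exact: Re_entry_le.
- by apply: filterS pV => x Vx; exact: Im_entry_le.
Qed.

Lemma L2D F H : L2V F -> L2V H -> L2V (F \+ H).
Proof.
move=> lF lH; apply: sandwich_L2.
  by apply: mxmeasurableD; [case: lF|case: lH].
have -> : (fun x => (F \+ H) x *m V x *m ((F \+ H) x)^t*) =
  ((fun x => F x *m V x *m (F x)^t*) \+ (fun x => F x *m V x *m (H x)^t*)) \+
  ((fun x => H x *m V x *m (F x)^t*) \+ (fun x => H x *m V x *m (H x)^t*)).
  by apply/funext => x /=; rewrite !mulmxDl adjD !mulmxDr.
by apply: mxintegrableD; apply: mxintegrableD; exact: L2_sandwich.
Qed.

Lemma L2Ml A F : L2V F -> L2V (lmul A F).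
Proof.
move=> lF; apply: sandwich_L2.
  by apply: mxmeasurableM; [exact: mxmeasurable_cst|case: lF].
have -> : (fun x => A *m F x *m V x *m (A *m F x)^t*) =
  (fun x => A *m (F x *m V x *m (F x)^t* *m A^t*)).
  by apply/funext => x; rewrite adjM !mulmxA.
by apply/mxintegrableMl/mxintegrableMr/L2_sandwich.
Qed.

Lemma subf_lmul F H : F \- H = F \+ lmul ((-1)%:M) H.
Proof. by apply/funext => x /=; rewrite mul_scalar_mx scaleN1r. Qed.

Lemma L2B F H : L2V F -> L2V H -> L2V (F \- H).
Proof. by move=> lF lH; rewrite subf_lmul; exact/L2D/L2Ml. Qed.

Lemma mxip_adj F H : L2V F -> L2V H -> ip H F = (ip F H)^t*.
Proof.
move=> lF lH; rewrite -mxintegral_adj; last exact: L2_sandwich.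
apply: eq_ae_mxintegral.
- by apply: mxmeasurable_sandwich; [case: lH|case: lF].
- by apply/mxmeasurable_adj/mxmeasurable_sandwich; [case: lF|case: lH].
- by apply: filterS pV => x Vx; rewrite adj_sandwich.
Qed.

Lemma mxipDl F H K : L2V F -> L2V H -> L2V K -> ip (F \+ H) K = ip F K + ip H K.
Proof.
move=> lF lH lK; rewrite /mxip -mxintegralD; [|exact: L2_sandwich..].
by congr mxintegral; apply/funext => x /=; rewrite !mulmxDl.
Qed.

Lemma mxipMl A F H : L2V F -> L2V H -> ip (lmul A F) H = A *m ip F H.
Proof.
move=> lF lH; rewrite /mxip -mxintegralMl; last exact: L2_sandwich.
by congr mxintegral; apply/funext => x /=; rewrite !mulmxA.
Qed.

Lemma mxipBl F H K : L2V F -> L2V H -> L2V K -> ip (F \- H) K = ip F K - ip H K.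
Proof.
move=> lF lH lK; have lm := L2Ml (-1)%:M lH.
by rewrite subf_lmul (mxipDl lF lm lK) (mxipMl _ lH lK) mul_scalar_mx scaleN1r.
Qed.

Lemma mxipDr F H K : L2V F -> L2V H -> L2V K -> ip K (F \+ H) = ip K F + ip K H.
Proof.
move=> lF lH lK; rewrite (mxip_adj (L2D lF lH) lK) (mxip_adj lF lK)
  (mxip_adj lH lK).
by rewrite (mxipDl lF lH lK) adjD.
Qed.

Lemma mxipBr F H K : L2V F -> L2V H -> L2V K -> ip K (F \- H) = ip K F - ip K H.
Proof.
move=> lF lH lK; rewrite (mxip_adj (L2B lF lH) lK) (mxip_adj lF lK)
  (mxip_adj lH lK).
by rewrite (mxipBl lF lH lK) adjB.
Qed.

Lemma mxipMr A F H : L2V F -> L2V H -> ip F (lmul A H) = ip F H *m A^t*.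
Proof.
move=> lF lH; rewrite (mxip_adj (L2Ml A lH) lF) (mxip_adj lH lF).
by rewrite (mxipMl A lH lF) adjM.
Qed.

(** Orthogonality and norms only need the real part of the scalar product:
    the modules at hand are stable under multiplication by every matrix, which
    recovers the whole matrix-valued inner product. *)
Definition rdot F H : R := complex.Re (scalar_prod mu V F H).

Lemma rdotE F H : L2V F -> L2V H ->
  rdot F H = \int[mu]_x pdot (V x) (F x) (H x).
Proof.
by move=> lF lH; rewrite /rdot /scalar_prod ntr_mxintegral//;
  exact: L2_sandwich.
Qed.

Lemma rdotC F H : L2V F -> L2V H -> rdot F H = rdot H F.
Proof.
by move=> lF lH; rewrite /rdot /scalar_prod (mxip_adj lH lF) ntr_adj ReJ.
Qed.

Lemma rdotDl F H K : L2V F -> L2V H -> L2V K ->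
  rdot (F \+ H) K = rdot F K + rdot H K.
Proof. by move=> lF lH lK;
  rewrite /rdot /scalar_prod (mxipDl lF lH lK) ntrD ReD. Qed.

Lemma rdotZl r F H : L2V F -> L2V H -> rdot (lmul (r%:C%:M) F) H = r * rdot F H.
Proof.
by move=> lF lH; rewrite /rdot /scalar_prod (mxipMl _ lF lH) mul_scalar_mx ntrZ
  ReZ.
Qed.

Lemma rdotBl F H K : L2V F -> L2V H -> L2V K ->
  rdot (F \- H) K = rdot F K - rdot H K.
Proof. by move=> lF lH lK;
  rewrite /rdot /scalar_prod (mxipBl lF lH lK) ntrD ntrN ReD ReN. Qed.

Lemma rdot_ge0 F : L2V F -> 0 <= rdot F F.
Proof.
move=> lF; rewrite rdotE//; apply: ae_Rintegral_ge0.
  exact: rint_measurable (L2_pdot lF).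
by apply: filterS pV => x Vx; exact: pdot_ge0.
Qed.

Lemma rdot_eq0 F : L2V F -> rdot F F = 0 -> {ae mu, forall x, F x = 0}.
Proof.
move=> lF; rewrite rdotE// => /(ae_Rintegral_eq0 (L2_pdot lF)) h.
have {}h : {ae mu, forall x, pdot (V x) (F x) (F x) = 0}.
  by apply: h; apply: filterS pV => x Vx; exact: pdot_ge0.
by apply: filterS2 pV h => x Vx; exact: pdot_eq0.
Qed.

Lemma rdot_expand t F H : L2V F -> L2V H ->
  rdot (F \+ lmul (t%:C%:M) H) (F \+ lmul (t%:C%:M) H) =
  rdot F F + 2 * t * rdot F H + t ^+ 2 * rdot H H.
Proof.
move=> lF lH; have lt := L2Ml (t%:C%:M) lH; have l := L2D lF lt.
rewrite (rdotDl lF lt l) (rdotC lF l) (rdotC lt l).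
rewrite (rdotDl lF lt lF) (rdotDl lF lt lt) (rdotC lF lt).
rewrite (rdotZl t lH lF) (rdotZl t lH lt) (rdotC lH lt) (rdotZl t lH lH).
rewrite (rdotC lH lF).
by move: (rdot F F) (rdot F H) (rdot H H) => a b c; ring.
Qed.

Lemma rdot_cauchy_schwarz F H : L2V F -> L2V H ->
  rdot F H ^+ 2 <= rdot F F * rdot H H.
Proof.
move=> lF lH; apply: quadratic_disc_le => [|t]; first exact: rdot_ge0.
by rewrite -(rdot_expand t lF lH); exact/rdot_ge0/L2D/L2Ml.
Qed.

Lemma L2norm_ge0 F : 0 <= L2norm mu V F.
Proof. exact: sqrtr_ge0. Qed.

Lemma sqr_L2norm F : L2V F -> L2norm mu V F ^+ 2 = rdot F F.
Proof. by move=> lF; rewrite sqr_sqrtr// rdot_ge0. Qed.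

Lemma ler_rdot F H : L2V F -> L2V H ->
  `|rdot F H| <= L2norm mu V F * L2norm mu V H.
Proof.
move=> lF lH; have := rdot_cauchy_schwarz lF lH.
rewrite -(sqr_L2norm lF) -(sqr_L2norm lH) -exprMn.
have := mulr_ge0 (L2norm_ge0 F) (L2norm_ge0 H).
move: (L2norm _ _ _ * _) (rdot _ _) => a b a0 ba.
by rewrite -ler_sqr ?nnegrE// real_normK ?num_real.
Qed.

End L2theory.

(** * Completeness of the weighted L2 module *)

Section L1.
Context d (T : measurableType d) (R : realType).
Variable mu : {measure set T -> \bar R}.

Lemma sum_half_le (c : R) n : 0 <= c -> \sum_(0 <= k < n) c / 2 ^+ k <= 2 * c.
Proof.
move=> c0; have -> : \sum_(0 <= k < n) c / 2 ^+ k = 2 * c - 2 * c / 2 ^+ n.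
  elim: n => [|n ih]; first by rewrite big_nil expr0 divr1 subrr.
  by rewrite big_nat_recr//= ih exprS; field; rewrite expf_neq0.
by rewrite gerBl divr_ge0 ?exprn_ge0// mulr_ge0.
Qed.

(** The sum of the increments has finite integral, hence is finite almost
    everywhere, and there the sequence converges absolutely. *)
Lemma ae_cvg_of_L1_geometric (u : nat -> T -> R) (c : R) :
  (forall n, measurable_fun setT (u n)) ->
  (forall n, \int[mu]_x (`|u n.+1 x - u n x|)%:E <= (c / 2 ^+ n)%:E)%E ->
  exists2 v : T -> R, measurable_fun setT v &
    {ae mu, forall x, u n x @[n --> \oo] --> v x}.
Proof.
move=> mu_ hu; pose g n x : \bar R := (`|u n.+1 x - u n x|)%:E.
have mg n : measurable_fun setT (g n).
  apply/measurable_EFinP; apply: measurableT_comp => //.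
  exact: measurable_funB.
have g0 n x : (0 <= g n x)%E by rewrite lee_fin.
have c0 : 0 <= c.
  rewrite -lee_fin; have := hu 0%N; rewrite expr0 divr1; apply: le_trans.
  exact: integral_ge0.
have mG : measurable_fun setT (fun x => \sum_(n <oo) g n x)%E.
  exact: ge0_emeasurable_sum.
have fin : mu.-integrable setT (fun x => \sum_(n <oo) g n x)%E.
  apply/integrableP; split=> //.
  under eq_integral do rewrite gee0_abs ?nneseries_ge0//.
  rewrite integral_nneseries//; apply: (@le_lt_trans _ _ (2 * c)%:E);
    last exact: ltry.
  apply: lime_le; first by apply: is_cvg_nneseries => n _ _;
    exact: integral_ge0.
  apply: nearW => n; apply: le_trans
    (_ : ((\sum_(0 <= k < n) c / 2 ^+ k)%:E <= _)%E).
    by rewrite -sumEFin; apply: lee_sum => k _; exact: hu.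
  by rewrite lee_fin sum_half_le.
(* the upper limit is measurable whether or not the sequence converges *)
exists (fun x => fine (limn_esup (fun n => (u n x)%:E))).
  apply: measurableT_comp => //; apply: measurable_fun_limn_esup => n.
  exact/measurable_EFinP.
apply: filterS (integrable_ae measurableT fin) => x /(_ I) fx.
suff /cvg_ex[l ul] : cvgn (fun n => u n x).
  have eul : (u n x)%:E @[n --> \oo] --> l%:E.
    by apply: cvg_EFin; [exact: nearW|exact: ul].
  by have [_ ->] := cvg_limn_einf_sup eul.
have : cvgn (series (telescope (u^~ x))).
  apply: normed_cvg; apply: nondecreasing_is_cvgn.
    apply/nondecreasing_seqP => n; rewrite /= /series /= big_nat_recr//=.
    by rewrite lerDl.
  exists (fine (\sum_(n <oo) g n x)%E) => _ [n _ <-].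
  rewrite -lee_fin fineK// /series /= -sumEFin.
  exact: (@nneseries_lim_ge _ (g^~ x) xpredT 0 n).
move=> /cvg_ex[l hl]; apply/cvg_ex; exists (u 0%N x + l).
rewrite (_ : (fun n => u n x) =
  (fun n => u 0%N x + series (telescope (u^~ x)) n)).
  by apply: cvgD => //; exact: cvg_cst.
by apply/funext => n; rewrite -eq_sum_telescope.
Qed.
End L1.

Section mxcvg.
Variable R : realType.
Local Notation C := (R[i]).

(** Convergence through real and imaginary parts, as measurability and
    integrability are expressed through them as well. *)
Definition ccvg (u : nat -> C) (l : C) : Prop :=
  complex.Re (u n) @[n --> \oo] --> complex.Re l /\
  complex.Im (u n) @[n --> \oo] --> complex.Im l.

Lemma ccvg_cst c : ccvg (fun=> c) c.
Proof. by split; exact: cvg_cst. Qed.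

Lemma ccvgD u v l m : ccvg u l -> ccvg v m -> ccvg (fun n => u n + v n) (l + m).
Proof.
move=> [u1 u2] [v1 v2]; split; rewrite ?ReD ?ImD.
  by under eq_fun do rewrite ReD; exact: cvgD.
by under eq_fun do rewrite ImD; exact: cvgD.
Qed.

Lemma ccvgM u v l m : ccvg u l -> ccvg v m -> ccvg (fun n => u n * v n) (l * m).
Proof.
move=> [u1 u2] [v1 v2]; split; rewrite ?ReM ?ImM.
  by under eq_fun do rewrite ReM; apply: cvgB; exact: cvgM.
by under eq_fun do rewrite ImM; apply: cvgD; exact: cvgM.
Qed.

Lemma ccvgJ u l : ccvg u l -> ccvg (fun n => (u n)^*%R) (l^*)%R.
Proof.
move=> [u1 u2]; split; rewrite ?ReJ ?ImJ.
  by under eq_fun do rewrite ReJ.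
by under eq_fun do rewrite ImJ; exact: cvgN.
Qed.

Lemma ccvg_sum I (s : seq I) (u : I -> nat -> C) (l : I -> C) :
  (forall i, ccvg (u i) (l i)) ->
  ccvg (fun n => \sum_(i <- s) u i n) (\sum_(i <- s) l i).
Proof.
move=> h; elim: s => [|i s ih].
  by rewrite big_nil; under eq_fun do rewrite big_nil; exact: ccvg_cst.
by rewrite big_cons; under eq_fun do rewrite big_cons; exact: ccvgD.
Qed.

Definition mxcvg q (A : nat -> 'M[C]_q) (L : 'M[C]_q) : Prop :=
  forall i j, ccvg (fun n => A n i j) (L i j).

Lemma cvg_pdot q (V : 'M[C]_q) A L : mxcvg A L ->
  pdot V (A n) (A n) @[n --> \oo] --> pdot V L L.
Proof.
move=> h.
have hM (B B' : nat -> 'M[C]_q) K K' : mxcvg B K -> mxcvg B' K' ->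
    mxcvg (fun n => B n *m B' n) (K *m K').
  move=> h1 h2 i j; rewrite mxE; under eq_fun do rewrite mxE.
  by apply: ccvg_sum => k; exact: ccvgM.
have h1 : mxcvg (fun n => A n *m V *m (A n)^t*) (L *m V *m L^t*).
  apply: (hM); first by apply: (hM _ (fun=> V)) => // i j; exact: ccvg_cst.
  by move=> i j; rewrite !mxE; under eq_fun do rewrite !mxE; exact: ccvgJ.
suff [] : ccvg (fun n => ntr (A n *m V *m (A n)^t*)) (ntr (L *m V *m L^t*)) by
  [].
by apply: ccvgM; [exact: ccvg_sum|exact: ccvg_cst].
Qed.

Lemma mxcvgB q (A : nat -> 'M[C]_q) L B : mxcvg A L ->
  mxcvg (fun n => A n - B) (L - B).
Proof.
move=> h i j; rewrite !mxE; under eq_fun do rewrite !mxE.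
by apply: ccvgD => //; exact: ccvg_cst.
Qed.
End mxcvg.

Section complete.
Context d (T : measurableType d) (R : realType) (q : nat).
Variable mu : {measure set T -> \bar R}.
Local Notation C := (R[i]).
Variable V : T -> 'M[C]_q.
Hypothesis tV : weight_tilde mu V.
Let hV : weight mu V := tV.1.
Implicit Types F H K P : T -> 'M[C]_q.
Implicit Types A B : 'M[C]_q.
Local Notation L2V := (L2 mu V).
Local Notation ip := (mxip mu V).
Local Notation lmul A F := (fun x => A *m F x).
Local Notation rd := (rdot mu V).

Lemma mul_inv_weight_ae :
  {ae mu, forall x, invweight V x *m V x *m (invweight V x)^t* = invweight V x}.
Proof.
apply: filterS hV.2 => x Vx; rewrite /invweight mulVmx ?posdef_unit// mul1mx.
by rewrite (posdef_adj (posdef_inv Vx)).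
Qed.

(** The form [V^-1 V V^-1] is [V^-1], which is integrable by assumption. *)
Lemma invweight_L2 : L2V (invweight V).
Proof.
have mV := mxintegrable_measurable tV.2.
apply: sandwich_L2 => //; apply: (eq_ae_mxintegrable _ tV.2 mul_inv_weight_ae).
exact: (mxmeasurable_sandwich hV).
Qed.

(** In the module of the weight [V], the function [V^-1] represents
    integration. *)
Lemma mxip_invweight F : L2V F -> ip F (invweight V) = mxintegral mu F.
Proof.
move=> lF; apply: eq_ae_mxintegral.
- apply: (mxmeasurable_sandwich hV); first by case: lF.
  exact: mxintegrable_measurable tV.2.
- by case: lF.
- apply: filterS hV.2 => x Vx.
  by rewrite /invweight (posdef_adj (posdef_inv Vx)) mulmxK// posdef_unit.
Qed.

(** [F] is [(t F) V (V^-1)^*] divided by [t]; the parameter [t] is the weight of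
    an arithmetic-geometric mean inequality, to be chosen large when [F] is
    small. *)
Lemma pdot_entry_ae F t : 0 < t -> {ae mu, forall x, forall i j,
  `|complex.Re (F x i j)| <= q%:R * (t * pdot (V x) (F x) (F x) +
     t^-1 * pdot (V x) (invweight V x) (invweight V x)) /\
  `|complex.Im (F x i j)| <= q%:R * (t * pdot (V x) (F x) (F x) +
     t^-1 * pdot (V x) (invweight V x) (invweight V x))}.
Proof.
move=> t0; apply: filterS hV.2 => x Vx i j.
have FE : t%:C *: F x = (t%:C *: F x) *m V x *m (invweight V x)^t*.
  by rewrite /invweight (posdef_adj (posdef_inv Vx)) mulmxK// posdef_unit.
have eR : complex.Re ((t%:C *: F x) i j) = t * complex.Re (F x i j).
  by rewrite mxE ReZ.
have eI : complex.Im ((t%:C *: F x) i j) = t * complex.Im (F x i j).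
  by rewrite mxE ImM /= mul0r addr0.
have := Re_entry_le Vx (t%:C *: F x) (invweight V x) i j.
have := Im_entry_le Vx (t%:C *: F x) (invweight V x) i j.
rewrite -FE eR eI pdotZl (pdotC Vx (F x)) pdotZl !normrM (gtr0_norm t0).
move: (pdot _ (F x) _) (pdot _ (invweight V x) _) => a b h1 h2.
have e : q%:R * (t * a + t^-1 * b) = (q%:R * (t * (t * a) + b)) / t.
  by field; rewrite gt_eqF.
by rewrite e !ler_pdivlMr// ![_ * t]mulrC.
Qed.

(** Integrated form of [pdot_entry_ae]: the [L^1] norms of the entries of [F]
    are controlled by its square norm in the module. *)
Lemma L1_entry_le F t : 0 < t -> L2V F -> forall i j,
  let c := (q%:R * (t * rd F F + t^-1 * rd (invweight V) (invweight V)))%:E in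
  (\int[mu]_x (`|complex.Re (F x i j)|)%:E <= c)%E /\
  (\int[mu]_x (`|complex.Im (F x i j)|)%:E <= c)%E.
Proof.
move=> t0 lF i j c; have lV := invweight_L2.
pose g x := q%:R * (t * pdot (V x) (F x) (F x) +
     t^-1 * pdot (V x) (invweight V x) (invweight V x)) : R.
have iF := L2_pdot lF; have iV := L2_pdot lV.
have ig : mu.-integrable setT (fun x => (g x)%:E).
  by apply/rintZ/rintD; exact: rintZ.
have cE : c = (\int[mu]_x g x)%:E.
  rewrite /c /g !(rdotE hV)// RintegralZl//; last by apply: rintD; exact: rintZ.
  by rewrite RintegralD//; [rewrite !RintegralZl//|exact: rintZ..].
have [mR mI] := lF.1 i j.
have aeR : {ae mu, forall x, `|complex.Re (F x i j)| <= g x}.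
  by apply: filterS (pdot_entry_ae F t0) => x /(_ i j)[].
have aeI : {ae mu, forall x, `|complex.Im (F x i j)| <= g x}.
  by apply: filterS (pdot_entry_ae F t0) => x /(_ i j)[].
have iR := rint_norm (rint_le_ae mR ig aeR).
have iI := rint_norm (rint_le_ae mI ig aeI).
by split; rewrite integral_EFin_Rintegral// cE lee_fin; exact: ae_le_Rintegral.
Qed.

(** Absolute values are taken because the form is nonnegative only almost
    everywhere. *)
Lemma L2_fatou (D : nat -> T -> 'M[C]_q) E (c : R) :
  (forall n, L2V (D n)) -> (forall n, rd (D n) (D n) <= c) ->
  mxmeasurable E -> {ae mu, forall x, mxcvg (D^~ x) (E x)} ->
  L2V E /\ rd E E <= c.
Proof.
move=> lD Dc mE DE.
pose h n x := `|pdot (V x) (D n x) (D n x)|.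
have ih n : mu.-integrable setT (fun x => (h n x)%:E).
  exact/rint_norm/L2_pdot.
have mh n : measurable_fun setT (fun x => (h n x)%:E).
  by have /integrableP[] := ih n.
have mpE : measurable_fun setT (fun x => pdot (V x) (E x) (E x)).
  by have [] := cmeasurable_ntr (mxmeasurable_sandwich hV mE mE).
have hE : (\int[mu]_x (`|pdot (V x) (E x) (E x)|)%:E <= c%:E)%E.
  apply: (@le_trans _ _ (\int[mu]_x limn_einf (fun n => (h n x)%:E))%E).
    rewrite le_eqVlt; apply/orP; left; apply/eqP.
    apply: ae_eq_integral => //.
    - by apply/measurable_EFinP; exact: measurableT_comp.
    - rewrite /limn_einf; apply: measurableT_comp => //.
      apply: (@measurable_fun_limn_esup _ _ _ _ (fun n x => - (h n x)%:E)%E).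
      by move=> n; exact: measurableT_comp.
    - apply: filterS DE => x DEx _.
      have hx : (h n x)%:E @[n --> \oo] --> (`|pdot (V x) (E x) (E x)|)%:E.
        apply: cvg_EFin; first exact: nearW.
        by apply: cvg_norm; exact: cvg_pdot.
      by have [-> _] := cvg_limn_einf_sup hx.
  apply: le_trans (fatou _ _ _ _) _ => //.
    by move=> n x _; rewrite lee_fin normr_ge0.
  rewrite limn_einf_lim; apply: lime_le; first exact: is_cvg_einfs.
  apply: nearW => n; apply: le_trans (_ : (\int[mu]_x (h n x)%:E <= _)%E).
    by apply: ereal_inf_lbound; exists n => //=.
  rewrite integral_EFin_Rintegral// lee_fin; apply: le_trans (Dc n).
  rewrite (rdotE hV)//; apply: ae_le_Rintegral => //; first exact: L2_pdot.
  by apply: filterS hV.2 => x Vx; rewrite /h ger0_norm ?pdot_ge0.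
have iE : mu.-integrable setT (fun x => (pdot (V x) (E x) (E x))%:E).
  apply/integrableP; split; first exact/measurable_EFinP.
  by apply: le_lt_trans hE _; exact: ltry.
have lE := pdot_L2 hV mE iE; split=> //.
rewrite (rdotE hV)// -lee_fin -integral_EFin_Rintegral//; apply: le_trans hE.
rewrite !integral_EFin_Rintegral//; last exact: rint_norm.
by rewrite lee_fin; apply: le_Rintegral => //;
  [exact: rint_norm|move=> x _; exact: ler_norm].
Qed.

End complete.

Section projection.
Context d (T : measurableType d) (R : realType) (q : nat).
Variable mu : {measure set T -> \bar R}.
Local Notation C := (R[i]).
Variable V : T -> 'M[C]_q.
Hypothesis tV : weight_tilde mu V.
Let hV : weight mu V := tV.1.
Implicit Types F H K P : T -> 'M[C]_q.
Implicit Types A B : 'M[C]_q.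
Local Notation L2V := (L2 mu V).
Local Notation ip := (mxip mu V).
Local Notation lmul A F := (fun x => A *m F x).
Local Notation rd := (rdot mu V).

Lemma cvg_comp_addn n (u : nat -> R) (l : R) :
  u m @[m --> \oo] --> l -> u (n + m)%N @[m --> \oo] --> l.
Proof. by move=> h; apply: cvg_comp h; exact: cvg_addnl. Qed.

(** With [t = 2 ^ n] in [L1_entry_le], the hypothesis makes the entries of the
    increments summable in [L^1], which gives a limit almost everywhere; the
    rate then passes to the limit by Fatou's lemma. A geometric rate costs no
    generality, since subsequences of Cauchy sequences have it. *)
Lemma L2_complete (F : nat -> T -> 'M[C]_q) :
  (forall n, L2V (F n)) ->
  (forall n m, (n <= m)%N -> rd (F m \- F n) (F m \- F n) <= 4^-1 ^+ n) ->
  exists2 P, L2V P & forall n, rd (P \- F n) (P \- F n) <= 4^-1 ^+ n.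
Proof.
move=> lF FC; set K := rd (invweight V) (invweight V).
have K0 : 0 <= K by exact/(rdot_ge0 hV)/(invweight_L2 tV).
have ent i j : exists v : T -> C, cmeasurable v /\
    {ae mu, forall x, ccvg (fun n => F n x i j) (v x)}.
  have bnd n : q%:R * (2 ^+ n * rd (F n.+1 \- F n) (F n.+1 \- F n) +
      (2 ^+ n)^-1 * K) <= (q%:R * (1 + K)) / 2 ^+ n.
    have := FC n n.+1 (leqnSn n); move: (rd _ _) => a ha.
    have -> : (q%:R * (1 + K)) / 2 ^+ n =
      q%:R * (2 ^+ n * 4^-1 ^+ n + (2 ^+ n)^-1 * K).
      have -> : (4^-1 : R) ^+ n = (2 ^+ n)^-1 * (2 ^+ n)^-1.
        by rewrite -!exprVn -exprMn; congr (_ ^+ _); field.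
      by field; rewrite expf_neq0.
    by rewrite ler_wpM2l ?ler0n// lerD2r ler_wpM2l ?exprn_ge0.
  have t0 n : 0 < 2 ^+ n :> R by rewrite exprn_gt0.
  have L1b n := L1_entry_le tV (t0 n) (L2B hV (lF n.+1) (lF n)) i j.
  have [v1 mv1 cv1] : exists2 v : T -> R, measurable_fun setT v &
      {ae mu, forall x, complex.Re (F n x i j) @[n --> \oo] --> v x}.
    apply: (@ae_cvg_of_L1_geometric _ _ _ _ _ (q%:R * (1 + K))) => n.
      exact: ((lF n).1 i j).1.
    rewrite (@eq_integral _ _ _ _ _
      (fun x => `|complex.Re ((F n.+1 \- F n) x i j)|%:E)) => [|x _].
      by apply: le_trans (L1b n).1 _; rewrite lee_fin.
    by rewrite /= !mxE ReD ReN.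
  have [v2 mv2 cv2] : exists2 v : T -> R, measurable_fun setT v &
      {ae mu, forall x, complex.Im (F n x i j) @[n --> \oo] --> v x}.
    apply: (@ae_cvg_of_L1_geometric _ _ _ _ _ (q%:R * (1 + K))) => n.
      exact: ((lF n).1 i j).2.
    rewrite (@eq_integral _ _ _ _ _
      (fun x => `|complex.Im ((F n.+1 \- F n) x i j)|%:E)) => [|x _].
      by apply: le_trans (L1b n).2 _; rewrite lee_fin.
    by rewrite /= !mxE ImD ImN.
  by exists (fun x => v1 x +i* v2 x); split=> //; exact: filterS2 cv1 cv2.
pose v i j := sval (cid (ent i j)).
have mv i j : cmeasurable (v i j) := (svalP (cid (ent i j))).1.
have cv i j : {ae mu, forall x, ccvg (fun n => F n x i j) (v i j x)} :=
  (svalP (cid (ent i j))).2.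
pose P x := \matrix_(i, j) v i j x.
have mP : mxmeasurable P by move=> i j; under eq_fun do rewrite mxE; exact: mv.
have cP : {ae mu, forall x, mxcvg (F^~ x) (P x)}.
  have : {ae mu, forall x, forall i j, ccvg (fun n => F n x i j) (v i j x)}.
    by apply: filter_forall => i; apply: filter_forall => j; exact: cv.
  by apply: filterS => x h i j; rewrite mxE; exact: h.
have key n : L2V (P \- F n) /\ rd (P \- F n) (P \- F n) <= 4^-1 ^+ n.
  apply: (@L2_fatou _ _ _ _ _ _ tV (fun m => F (n + m)%N \- F n)).
  - by move=> m; exact: L2B.
  - by move=> m; apply: FC; exact: leq_addr.
  - move=> i j; rewrite /= (_ : (fun x => _) = fun x => P x i j + (-1) * F n x i
    j).
      apply: cmeasurableD; first exact: mP.
      by apply: cmeasurableM; [exact: cmeasurable_cst|exact: (lF n).1].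
    by apply/funext => x; rewrite !mxE mulN1r.
  - apply: filterS cP => x h; apply: mxcvgB => i j.
    have [h1 h2] := h i j; split; first exact: (cvg_comp_addn n h1).
    exact: (cvg_comp_addn n h2).
exists P; last by move=> n; have [] := key n.
have -> : P = (P \- F 0%N) \+ F 0%N by apply/funext => x /=; rewrite subrK.
by apply: L2D => //; have [] := key 0%N.
Qed.

Lemma rdot_subE F H : L2V F -> L2V H ->
  rd (F \- H) (F \- H) = rd F F - 2 * rd F H + rd H H.
Proof.
move=> lF lH; have lB := L2B hV lF lH.
rewrite (rdotBl hV lF lH lB) (rdotC hV lF lB) (rdotC hV lH lB).
rewrite (rdotBl hV lF lH lF) (rdotBl hV lF lH lH) (rdotC hV lH lF).
by move: (rd F F) (rd F H) (rd H H) => a b c; ring.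
Qed.

(** The parallelogram law, in the form in which the midpoint of two
    approximations from a submodule appears. *)
Lemma rdot_midpoint F H : L2V F -> L2V H ->
  rd (F \- H) (F \- H) + 4 * rd (lmul (2^-1%:C%:M) (F \+ H))
    (lmul (2^-1%:C%:M) (F \+ H))
  = 2 * rd F F + 2 * rd H H.
Proof.
move=> lF lH; have lD := L2D hV lF lH; have lm := L2Ml hV (2^-1%:C%:M) lD.
rewrite (rdot_subE lF lH) (rdotZl hV _ lD lm) (rdotC hV lD lm)
  (rdotZl hV _ lD lD).
rewrite (rdotDl hV lF lH lD) (rdotC hV lF lD) (rdotC hV lH lD).
rewrite (rdotDl hV lF lH lF) (rdotDl hV lF lH lH) (rdotC hV lH lF).
by move: (rd F F) (rd F H) (rd H H) => a b c; field.
Qed.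

End projection.

(** * Orthogonal projections onto closures of submodules *)

Section pow.
Variable R : realType.
Lemma le0_of_geometric_le (a c : R) : (forall n, a <= c * 4^-1 ^+ n) -> a <= 0.
Proof.
move=> h; have hc : c * 4^-1 ^+ n @[n --> \oo] --> c * 0.
  apply: cvgM; first exact: cvg_cst.
  by apply: cvg_expr; rewrite ger0_norm ?invr_ge0// invf_lt1// ltr1n.
rewrite -(mulr0 c) -(cvg_lim _ hc)//; apply: limr_ge; first exact: cvgP hc.
exact: nearW.
Qed.

Lemma exists_geometric_lt (e : R) : 0 < e -> exists n, 4^-1 ^+ n < e.
Proof.
move=> e0; apply: contrapT => /forallNP h.
suff : e <= 0 by rewrite leNgt e0.
apply: (@le0_of_geometric_le _ 1) => n; rewrite mul1r leNgt; exact/negP.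
Qed.
End pow.

Section adj.
Context {R : realType} {q : nat}.
Local Notation C := (R[i]).

Lemma posdef1 : posdefmx (1%:M : 'M[C]_q).
Proof.
split; first by apply/is_hermitianmxP; rewrite expr0 scale1r adj1.
move=> v v0; rewrite mulmx1 mxE lt_def; apply/andP; split; last first.
  by apply: sumr_ge0 => i _; rewrite !mxE mul_conjC_ge0.
apply: contra v0; rewrite psumr_eq0 => [/allP h|i _]; last first.
  by rewrite !mxE mul_conjC_ge0.
apply/eqP/rowP => i; have := h i (mem_index_enum _).
by rewrite !mxE mul_conjC_eq0 => /eqP.
Qed.

Lemma ntr_mul_adj_eq0 (A : 'M[C]_q) : complex.Re (ntr (A *m A^t*)) = 0 -> A = 0.
Proof. by move=> h; apply: (pdot_eq0 posdef1); rewrite /pdot mulmx1. Qed.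
End adj.

Section projection.
Context d (T : measurableType d) (R : realType) (q : nat).
Variable mu : {measure set T -> \bar R}.
Local Notation C := (R[i]).
Variable V : T -> 'M[C]_q.
Hypothesis hV : weight mu V.
Implicit Types F H K P : T -> 'M[C]_q.
Implicit Types A B : 'M[C]_q.
Implicit Type M : set (T -> 'M[C]_q).
Local Notation L2V := (L2 mu V).
Local Notation ip := (mxip mu V).
Local Notation lmul A F := (fun x => A *m F x).
Local Notation rd := (rdot mu V).

Lemma rdotMl_adj A F H : L2V F -> L2V H ->
  rd F (lmul A H) = complex.Re (ntr (ip F H *m A^t*)).
Proof. by move=> lF lH; rewrite /rdot /scalar_prod (mxipMr hV). Qed.

Definition lmul_closed M := forall A F, M F -> M (lmul A F).

(** Orthogonality to [A H] with [A = (K, H)] says that the trace of [A A^*]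
    vanishes. *)
Lemma mxip_eq0_of_rdot M K : lmul_closed M -> M `<=` L2V -> L2V K ->
  (forall H, M H -> rd K H = 0) -> forall H, M H -> ip K H = 0.
Proof.
move=> Mm ML lK h H MH; apply: ntr_mul_adj_eq0.
by rewrite -(rdotMl_adj _ lK (ML _ MH)) (h _ (Mm _ _ MH)).
Qed.

Lemma sub_L2closure M : M `<=` L2V -> M `<=` L2closure mu V M.
Proof.
move=> ML H MH; split; first exact: ML.
move=> e e0; exists H => //; have lH := ML _ MH.
suff -> : L2norm mu V (H \- H) = 0 by [].
rewrite /L2norm -[complex.Re _]/(rd (H \- H) (H \- H)).
rewrite (rdotBl hV lH lH (L2B hV lH lH)).
by move: (rd _ _) => r; rewrite subrr sqrtr0.
Qed.

Lemma rdot_closure_eq0 M K : M `<=` L2V -> L2V K ->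
  (forall H, M H -> rd K H = 0) -> forall H, L2closure mu V M H -> rd K H = 0.
Proof.
move=> ML lK h H [lH clH]; apply/eqP; rewrite -normr_eq0 eq_le normr_ge0 andbT.
apply/ler_addgt0Pr => e e0; rewrite add0r.
set k := L2norm mu V K; have k0 : 0 <= k := L2norm_ge0 _ _ _.
have k1 : 0 < k + 1 by rewrite ltr_wpDl.
have [H' MH' HH'] := clH (e / (k + 1)) (divr_gt0 e0 k1).
have lH' := ML _ MH'; have lB := L2B hV lH lH'.
have -> : rd K H = rd K (H \- H').
  by rewrite (rdotC hV lK lB) (rdotBl hV lH lH' lK) -(rdotC hV lK lH')
    (h _ MH') subr0 (rdotC hV lH lK).
apply: le_trans (ler_rdot hV lK lB) _; rewrite -/k.
apply: (@le_trans _ _ ((k + 1) * (e / (k + 1)))); last first.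
  by rewrite mulrC divfK// gt_eqF.
have := L2norm_ge0 mu V (H \- H'); move: HH' k0; rewrite -/k.
move: (L2norm _ _ (H \- H')) k {k1} => y k yl k0 y0.
by apply: ler_pM => //; [rewrite lerDl|exact: ltW].
Qed.

(** With [A = (K, H)], the real inner product of [A^* K] with [H] is the real
    part of the trace of [A^* A]; it vanishes by continuity in [H]. *)
Lemma mxip_closure_eq0 M K : M `<=` L2V -> L2V K ->
  (forall H, M H -> ip K H = 0) -> forall H, L2closure mu V M H -> ip K H = 0.
Proof.
move=> ML lK h H clH; have lH := clH.1; set A := ip K H.
have lK' := L2Ml hV (A^t*) lK.
have : rd (lmul (A^t*) K) H = 0.
  apply: (rdot_closure_eq0 ML lK') clH => H' MH'.
  by rewrite /rdot /scalar_prod (mxipMl hV _ lK (ML _ MH')) h// mulmx0 ntr0.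
rewrite /rdot /scalar_prod (mxipMl hV _ lK lH) -/A.
rewrite /ntr mxtrace_mulC; exact: ntr_mul_adj_eq0.
Qed.

(** For a submodule, the scalar orthogonality in the definition of a projection
    upgrades to the matrix-valued inner product. *)
Lemma is_orthproj_mxip M N F P : lmul_closed N -> N `<=` M -> M `<=` L2V ->
  L2V F -> is_orthproj mu V M F P -> forall H, N H -> ip (F \- P) H = 0.
Proof.
move=> Nm NM ML lF [MP h].
apply: (mxip_eq0_of_rdot Nm _ (L2B hV lF (ML _ MP))).
  by move=> H /NM /ML.
by move=> H /NM MH; rewrite /rdot (h _ MH).
Qed.

End projection.

Section exists_proj.
Context d (T : measurableType d) (R : realType) (q : nat).
Variable mu : {measure set T -> \bar R}.
Local Notation C := (R[i]).
Variable V : T -> 'M[C]_q.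
Hypothesis tV : weight_tilde mu V.
Let hV : weight mu V := tV.1.
Local Notation L2V := (L2 mu V).
Local Notation ip := (mxip mu V).
Local Notation lmul A F := (fun x => A *m F x).
Local Notation rd := (rdot mu V).

(** A minimizing sequence [H n] is Cauchy by the parallelogram law, and [P] is
    its limit. Near-minimality of [H n] along the line through [H n] in a
    direction [K] bounds [(F - H n, K)] by a discriminant, so [(F - P, K)]
    vanishes. *)
Lemma exists_orthproj_L2closure (M : set (T -> 'M[C]_q)) F :
  M (fun=> 0) -> (forall H K, M H -> M K -> M (H \+ K)) -> lmul_closed M ->
  M `<=` L2V -> L2V F -> exists P, is_orthproj mu V (L2closure mu V M) F P.
Proof.
move=> M0 MD Mm ML lF.
pose D := [set rd (F \- H) (F \- H) | H in M].
have D0 : lbound D 0 by move=> _ [H /ML lH <-]; exact/(rdot_ge0 hV)/(L2B hV).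
have hD : has_inf D by split;
  [exists (rd (F \- fun=> 0) (F \- fun=> 0)), (fun=> 0)|exists 0].
have dle H : M H -> inf D <= rd (F \- H) (F \- H).
  by move=> MH; apply: ge_inf; [exists 0|exists H].
(* tolerance such that the parallelogram law gives the rate [4^-n] below *)
have e0 n : 0 < (4^-1 : R) ^+ n / 4 by rewrite divr_gt0 ?exprn_gt0 ?invr_gt0.
have ex n : exists H, M H /\ rd (F \- H) (F \- H) < inf D + 4^-1 ^+ n / 4.
  by have [_ [H MH <-] lt] := inf_adherent (e0 n) hD; exists H.
pose H n := sval (cid (ex n)).
have MH n : M (H n) := (svalP (cid (ex n))).1.
have Hd n : rd (F \- H n) (F \- H n) < inf D + 4^-1 ^+ n / 4 :=
  (svalP (cid (ex n))).2.
have lH n : L2V (H n) := ML _ (MH n).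
have lFH n : L2V (F \- H n) := L2B hV lF (lH n).
have cauchy n m : (n <= m)%N -> rd (H m \- H n) (H m \- H n) <= 4^-1 ^+ n.
  move=> nm; have := rdot_midpoint tV (lFH n) (lFH m).
  have -> : (F \- H n) \- (F \- H m) = H m \- H n.
    by apply/funext => x /=; rewrite opprB addrC addrA subrK.
  have -> : lmul (2^-1%:C%:M) ((F \- H n) \+ (F \- H m)) =
      F \- lmul (2^-1%:C%:M) (H n \+ H m).
    apply/funext => x /=; rewrite !mul_scalar_mx -{3}[F x]scale1r.
    have -> : (1 : C) = 2^-1%:C + 2^-1%:C.
      by rewrite -rmorphD /= -[LHS](rmorph1 (real_complex R)); congr (_%:C);
        field.
    by rewrite scalerDl !scalerDr !scalerN opprD addrACA.
  have := dle _ (Mm (2^-1%:C%:M) _ (MD _ _ (MH n) (MH m))).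
  have := Hd n; have := Hd m.
  have : (4^-1 : R) ^+ m <= 4^-1 ^+ n.
    by rewrite ler_wiXn2l ?invr_ge0// invf_le1// ler1n.
  move: (rd (H m \- _) _) (rd (F \- lmul _ _) _) (rd (F \- H n) _)
    (rd (F \- H m) _).
  by move: (inf D) ((4^-1 : R) ^+ n) ((4^-1 : R) ^+ m) => i a b w x y z; lra.
have [P lP HP] := L2_complete tV lH cauchy.
exists P; split.
  split=> // e e_gt0; have [n ne] := exists_geometric_lt (exprn_gt0 2 e_gt0).
  exists (H n) => //; rewrite -ltr_sqr ?nnegrE ?L2norm_ge0 1?ltW//.
  by rewrite (sqr_L2norm hV (L2B hV lP (lH n))); exact: le_lt_trans ne.
have orth K : M K -> rd (F \- P) K = 0.
  move=> MK; have lK := ML _ MK; have lFP := L2B hV lF lP.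
  apply/eqP; rewrite -sqrf_eq0 eq_le sqr_ge0 andbT.
  apply: (@le0_of_geometric_le _ _ (4 * rd K K)) => n.
  have cs1 : rd (F \- H n) K ^+ 2 <= 4^-1 ^+ n / 4 * rd K K.
    apply: quadratic_disc_le => [|t]; first exact: (rdot_ge0 hV).
    have := dle _ (MD _ _ (MH n) (Mm ((- t)%:C%:M) _ MK)).
    have -> : F \- (H n \+ lmul ((- t)%:C%:M) K) = (F \- H n) \+ lmul (t%:C%:M)
      K.
      apply/funext => x /=; rewrite !mul_scalar_mx opprD addrA; congr (_ + _).
      by rewrite rmorphN scaleNr opprK.
    rewrite (rdot_expand hV t (lFH n) lK); have := Hd n.
    move: (rd K K) (rd _ K) (rd (F \- _) _) (inf D) => c b a i.
    by move: (_ ^+ n) => w; lra.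
  have cs2 : rd (P \- H n) K ^+ 2 <= 4^-1 ^+ n * rd K K.
    apply: le_trans (rdot_cauchy_schwarz hV (L2B hV lP (lH n)) lK) _.
    by rewrite ler_wpM2r ?HP// (rdot_ge0 hV).
  have -> : rd (F \- P) K = rd (F \- H n) K - rd (P \- H n) K.
    rewrite (rdotBl hV lF lP lK) (rdotBl hV lF (lH n) lK)
      (rdotBl hV lP (lH n) lK).
    by move: (rd F K) (rd P K) (rd (H n) K) => a b c; ring.
  have := rdot_ge0 hV lK; have : 0 <= (4^-1 : R) ^+ n by rewrite exprn_ge0
    ?invr_ge0.
  move: cs1 cs2; move: (rd _ _) (rd _ _) (rd _ _) (_ ^+ n) => a b c e h1 h2 h3
    h4.
  have := mulr_ge0 h3 h4; have := sqr_ge0 (a + b).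
  by nra.
move=> K clK; rewrite /scalar_prod.
have lFP := L2B hV lF lP.
rewrite (mxip_closure_eq0 hV ML lFP _ clK) ?ntr0//.
exact: (mxip_eq0_of_rdot hV).
Qed.

End exists_proj.

(** * Duality between the modules of a weight and of its inverse *)

Section transport.
Context d (T : measurableType d) (R : realType) (q : nat).
Variable mu : {measure set T -> \bar R}.
Local Notation C := (R[i]).
Variable W : T -> 'M[C]_q.
Hypothesis tW : weight_tilde mu W.
Let hW : weight mu W := tW.1.
Let mW : mxmeasurable W := mxintegrable_measurable hW.1.
Let mV : mxmeasurable (invweight W) := mxintegrable_measurable tW.2.
Implicit Types F H K P : T -> 'M[C]_q.
Local Notation mulr F U := (fun x => F x *m U x).

Lemma invweight_weight : weight mu (invweight W).
Proof. by split; [case: tW|apply: filterS hW.2 => x; exact: posdef_inv]. Qed.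

Lemma mxmeasurable_L2 V F : L2 mu V F -> mxmeasurable F.
Proof. by case. Qed.

Lemma sandwich_mulr_weight F H x : posdefmx (W x) ->
  (F x *m W x) *m invweight W x *m (H x *m W x)^t* = F x *m W x *m (H x)^t*.
Proof.
move=> Wx; rewrite adjM (posdef_adj Wx) /invweight mulmxK ?posdef_unit//.
by rewrite mulmxA.
Qed.

Lemma sandwich_mulr_inv F H x : posdefmx (W x) ->
  F x *m W x *m (H x *m invweight W x)^t* = F x *m (H x)^t*.
Proof.
move=> Wx; rewrite adjM /invweight (posdef_adj (posdef_inv Wx)) mulmxA.
by rewrite mulmxK// posdef_unit.
Qed.

Lemma sandwich_mulr_inv2 F H x : posdefmx (W x) ->
  (F x *m invweight W x) *m W x *m (H x *m invweight W x)^t* =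
  F x *m invweight W x *m (H x)^t*.
Proof. by move=> Wx; rewrite (sandwich_mulr_inv (mulr F (invweight W)) H Wx).
Qed.

Lemma L2_mulr_weight F : L2 mu W F -> L2 mu (invweight W) (mulr F W).
Proof.
move=> lF; have mF := mxmeasurable_L2 lF.
have mFW : mxmeasurable (mulr F W) by exact: mxmeasurableM.
apply: (sandwich_L2 mFW); apply: eq_ae_mxintegrable (L2_sandwich hW lF lF) _.
  exact: (mxmeasurable_sandwich invweight_weight).
by apply: filterS hW.2 => x; exact: sandwich_mulr_weight.
Qed.

Lemma L2_mulr_invweight F : L2 mu (invweight W) F ->
  L2 mu W (mulr F (invweight W)).
Proof.
move=> lF; have mF := mxmeasurable_L2 lF.
have mFV : mxmeasurable (mulr F (invweight W)) by exact: mxmeasurableM.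
apply: (sandwich_L2 mFV).
apply: eq_ae_mxintegrable (L2_sandwich invweight_weight lF lF) _.
  exact: (mxmeasurable_sandwich hW).
by apply: filterS hW.2 => x; exact: sandwich_mulr_inv2.
Qed.

Lemma mxip_mulr_weight F H : L2 mu W F -> L2 mu W H ->
  mxip mu (invweight W) (mulr F W) (mulr H W) = mxip mu W F H.
Proof.
move=> lF lH; have mF := mxmeasurable_L2 lF; have mH := mxmeasurable_L2 lH.
apply: eq_ae_mxintegral.
- by apply: (mxmeasurable_sandwich invweight_weight); exact: mxmeasurableM.
- exact: (mxmeasurable_sandwich hW).
- by apply: filterS hW.2 => x; exact: sandwich_mulr_weight.
Qed.

(** The pairing that defines dual modules is an inner product of [L^2(W)]. *)
Lemma mxintegral_mul_adj F H : L2 mu W F -> L2 mu (invweight W) H ->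
  mxintegral mu (fun x => F x *m (H x)^t*) = mxip mu W F (mulr H (invweight W)).
Proof.
move=> lF lH; have mF := mxmeasurable_L2 lF; have mH := mxmeasurable_L2 lH.
apply: eq_ae_mxintegral.
- by apply: mxmeasurableM => //; exact: mxmeasurable_adj.
- by apply: (mxmeasurable_sandwich hW) => //; exact: mxmeasurableM.
- by apply: filterS hW.2 => x Wx; rewrite (sandwich_mulr_inv F H Wx).
Qed.

Lemma mxip_mulr_weight_l F H : L2 mu W F -> L2 mu (invweight W) H ->
  mxip mu (invweight W) (mulr F W) H = mxip mu W F (mulr H (invweight W)).
Proof.
move=> lF lH; have mF := mxmeasurable_L2 lF; have mH := mxmeasurable_L2 lH.
apply: eq_ae_mxintegral.
- by apply: (mxmeasurable_sandwich invweight_weight) => //;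
  exact: mxmeasurableM.
- by apply: (mxmeasurable_sandwich hW) => //; exact: mxmeasurableM.
- apply: filterS hW.2 => x Wx; rewrite (sandwich_mulr_inv F H Wx).
  by rewrite /invweight mulmxK// posdef_unit.
Qed.

Lemma mulr_weightK F :
  {ae mu, forall x, F x *m W x *m invweight W x = F x}.
Proof.
by apply: filterS hW.2 => x Wx; rewrite /invweight mulmxK// posdef_unit.
Qed.

End transport.

Section unique.
Context d (T : measurableType d) (R : realType) (q : nat).
Variable mu : {measure set T -> \bar R}.
Local Notation C := (R[i]).
Variable V : T -> 'M[C]_q.
Hypothesis hV : weight mu V.

(** Projections are functions, not classes, so they agree only almost
    everywhere. *)
Lemma is_orthproj_unique (M : set (T -> 'M[C]_q)) F P Q :
  M `<=` L2 mu V -> (forall H K, M H -> M K -> M (H \- K)) -> L2 mu V F ->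
  is_orthproj mu V M F P -> is_orthproj mu V M F Q ->
  {ae mu, forall x, P x = Q x}.
Proof.
move=> ML MB lF [MP oP] [MQ oQ]; have MPQ := MB _ _ MP MQ.
have lP := ML _ MP; have lQ := ML _ MQ; have lPQ := ML _ MPQ.
suff : rdot mu V (P \- Q) (P \- Q) = 0.
  by move=> /(rdot_eq0 hV lPQ); apply: filterS => x /= /eqP;
    rewrite subr_eq0 => /eqP.
have e : P \- Q = (F \- Q) \- (F \- P).
  by apply/funext => x /=; rewrite opprB [RHS]addrC addrA subrK.
rewrite {1}e (rdotBl hV (L2B hV lF lQ) (L2B hV lF lP) lPQ).
by rewrite /rdot (oP _ MPQ) (oQ _ MPQ) subrr.
Qed.
End unique.

Section dualmodule.
Context d (T : measurableType d) (R : realType) (q : nat).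
Variable mu : {measure set T -> \bar R}.
Local Notation C := (R[i]).

Lemma dualmodB W (M : set (T -> 'M[C]_q)) H K : weight_tilde mu W ->
  M `<=` L2 mu W -> dualmod mu W M H -> dualmod mu W M K ->
    dualmod mu W M (H \- K).
Proof.
move=> tW ML [lH oH] [lK oK]; have hi := invweight_weight tW.
have lB := L2B hi lH lK; split; first exact: lB.
move=> F MF; have lF := ML _ MF.
have lHV := L2_mulr_invweight tW lH; have lKV := L2_mulr_invweight tW lK.
have := oK _ MF; have := oH _ MF.
rewrite (mxintegral_mul_adj tW lF lB) (mxintegral_mul_adj tW lF lH).
rewrite (mxintegral_mul_adj tW lF lK) => h1 h2.
have -> : (fun x => (H \- K) x *m invweight W x) =
  (fun x => H x *m invweight W x) \- (fun x => K x *m invweight W x).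
  by apply/funext => x /=; rewrite mulmxBl.
by rewrite (mxipBr tW.1 lHV lKV lF) h1 h2 subrr.
Qed.
End dualmodule.

(** * Characters under the Haar measure *)

Section haar.
Variables (R : realType) (G : zmodType).
Local Notation C := (R[i]).
Local Notation Cprod := (prod_topology (fun _ : G => C^o)).

Lemma dual_eval_continuous g : continuous (fun x : dual R G => x g : C^o).
Proof.
move=> x; apply: (@continuous_comp _ _ _ (@dual_fun R G : _ -> Cprod)
  (@proj _ (fun _ : G => C^o) g)).
  exact: initial_continuous.
exact: proj_continuous.
Qed.

Lemma dual_continuous (S : topologicalType) (f : S -> dual R G) :
  (forall g, continuous (fun s => f s g : C^o)) -> continuous f.
Proof.
move=> cf; apply: (@continuous_comp_initial _ _ _ (@dual_fun R G : _ -> Cprod)).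
move=> s; apply/cvg_sup => g; move: s.
apply/(@continuousP _ (initial_topology (@^~ g))) => A [B oB <-].
have /continuousP := cf g; exact.
Qed.

Lemma Re_continuous : continuous (fun z : C^o => complex.Re z).
Proof.
move=> z U /nbhs_ballP[e /= e0 eU]; apply/(@nbhs_ballP _ C^o).
exists e%:C; first by rewrite /= ltcR.
move=> w; rewrite -ball_normE /= => zw; apply: eU; rewrite -ball_normE /= -ltcR.
apply: le_lt_trans zw; rewrite -ReN -ReD; exact: normc_ge_Re.
Qed.

Lemma Im_continuous : continuous (fun z : C^o => complex.Im z).
Proof.
move=> z; have -> : (fun z : C^o => complex.Im z) =
  (fun z : C^o => complex.Re (- 'i%C * z)).
  by apply/funext => w; rewrite mulNr ReN mulrC ReiNIm opprK.
apply: (@continuous_comp C^o C^o R (fun z : C^o => - 'i%C * z : C^o)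
  (fun z : C^o => complex.Re z)).
  by apply: (@mulrl_continuous C).
exact: Re_continuous.
Qed.

Lemma dual_open_measurable (A : set (dual R G)) : open A -> measurable A.
Proof. by move=> oA; exact: sub_sigma_algebra. Qed.

Lemma dual_continuous_measurable (f : dual R G -> R) :
  continuous f -> measurable_fun setT f.
Proof.
move=> /continuousP cf; apply: (measurability _ (RGenOpens.measurableE R)).
move=> _ [_ [a [b ->] <-]]; rewrite setTI; apply: dual_open_measurable.
exact/cf/interval_open.
Qed.

Lemma cmeasurable_dual g : cmeasurable (fun x : dual R G => x g).
Proof.
split; apply: dual_continuous_measurable => x.
  apply: (@continuous_comp _ C^o R _ (fun z : C^o => complex.Re z)).
    exact: dual_eval_continuous.
  exact: Re_continuous.
apply: (@continuous_comp _ C^o R _ (fun z : C^o => complex.Im z)).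
  exact: dual_eval_continuous.
exact: Im_continuous.
Qed.

Lemma dual_mul_continuous (x0 : dual R G) : continuous (dual_mul x0).
Proof.
apply: dual_continuous => g x /=.
apply: (@continuous_comp _ C^o C^o (fun x : dual R G => x g : C^o)
  (fun z : C^o => x0 g * z : C^o)).
  exact: dual_eval_continuous.
exact: (@mulrl_continuous C).
Qed.

Lemma dual_mul_measurable (x0 : dual R G) :
  measurable_fun setT (dual_mul x0).
Proof.
apply: (measurability (@open (dual R G))) => // _ [A oA <-].
rewrite setTI; apply: dual_open_measurable.
by have /continuousP := @dual_mul_continuous x0; apply.
Qed.

Lemma dual_ext (x y : dual R G) : (forall g, x g = y g) -> x = y.
Proof.
case: x y => [x cx] [y cy] /= /funext e; rewrite -e in cy *.
by congr Dual; exact: Prop_irrelevance.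
Qed.

Lemma is_character_conj (x : dual R G) : is_character (fun g => (x g)^*%R).
Proof.
case: x => x [x1 xD]; split=> [g|g h] /=; first by rewrite norm_conjC.
by rewrite xD rmorphM.
Qed.

Definition dual_inv (x : dual R G) : dual R G := Dual (is_character_conj x).

Lemma dual_mulK (x0 x : dual R G) : dual_mul (dual_inv x0) (dual_mul x0 x) = x.
Proof.
apply: dual_ext => g /=; rewrite mulrA [X in X * _]mulrC -normCK.
by case: (dualP x0) => -> _; rewrite expr1n mul1r.
Qed.

Lemma dual_mulVK (x0 x : dual R G) : dual_mul x0 (dual_mul (dual_inv x0) x) = x.
Proof.
apply: dual_ext => g /=; rewrite mulrA -normCK.
by case: (dualP x0) => -> _; rewrite expr1n mul1r.
Qed.

Section haar_measure.
Variable mu : probability (dual R G) R.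
Hypothesis haar : is_haar mu.

(** The image of the measure under a translation is the measure itself. *)
Lemma Rintegral_translate (x0 : dual R G) (f : dual R G -> R) :
  mu.-integrable setT (fun x => (f x)%:E) ->
  mu.-integrable setT (fun x => (f (dual_mul x0 x))%:E) ->
  \int[mu]_x f (dual_mul x0 x) = \int[mu]_x f x.
Proof.
move=> fi fi0; congr fine.
have mf : measurable_fun setT (EFin \o f) by case/integrableP: fi.
have := @integral_pushforward _ _ _ _ _ _ (dual_mul_measurable x0) mu setT _ mf
  fi0 measurableT.
rewrite preimage_setT => <-.
apply: eq_measure_integral => [|? A mA _]; first exact: dual_mul_measurable.
have [inv _ _] := haar.
have mA' : measurable (dual_mul x0 @^-1` A).
  by rewrite -[X in measurable X]setTI; exact: dual_mul_measurable.
have <- : dual_mul x0 @` (dual_mul x0 @^-1` A) = A.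
  apply/seteqP; split => [_ [x Ax <-]//|x Ax].
  by exists (dual_mul (dual_inv x0) x); rewrite /= dual_mulVK.
rewrite [RHS]inv//; congr (mu _); apply/seteqP; split => [x /= [y Ay]|x Ax] /=.
  by move=> /(congr1 (dual_mul (dual_inv x0))); rewrite !dual_mulK => <-.
by exists x.
Qed.

Lemma cintegrable_dual g : cintegrable mu (fun x => x g).
Proof.
have h (x : dual R G) : `|complex.Re (x g)| <= 1 /\ `|complex.Im (x g)| <= 1.
  have x1 : `|x g| = 1 by case: (dualP x).
  split; rewrite -lecR -[leRHS]x1; first exact: normc_ge_Re.
  rewrite -normrN -ReiNIm (le_trans (normc_ge_Re _))// normrM.
  suff -> : `|'i%C| = 1 :> C by rewrite mulr1.
  by rewrite normc_def /= expr0n expr1n add0r sqrtr1.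
apply: (@cintegrable_le _ _ _ _ _ (fun=> 1)); first exact: cmeasurable_dual.
- exact: finite_measure_integrable_cst.
- by apply: aeW => x; have [] := h x.
- by apply: aeW => x; have [] := h x.
Qed.

(** Translation by [x0] multiplies the integral by [x0 g], which can be made
    different from [1]. *)
Lemma cintegral_dual_eq0 g : g <> 0 -> cintegral mu (fun x => x g) = 0.
Proof.
move=> g0; have [x0 x0g] := exists_character_neq1 R g0.
have ig := cintegrable_dual g.
have : cintegral mu (fun x => x0 g * x g) = cintegral mu (fun x => x g).
  have [i1 i2] := ig; have [j1 j2] := cintegrableZ (x0 g) ig.
  apply: eq_ReIm => /=.
    exact: (@Rintegral_translate x0 (fun x => complex.Re (x g))).
  exact: (@Rintegral_translate x0 (fun x => complex.Im (x g))).
rewrite cintegralZ// => h; apply/eqP; move: h; apply: contra_eqT => c0.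
by rewrite -subr_eq0 -{2}[cintegral _ _]mul1r -mulrBl mulf_neq0// subr_eq0.
Qed.
End haar_measure.
End haar.

(** * Trigonometric polynomials *)

Section trigpoly.
Variables (R : realType) (G : zmodType) (lambda : probability (dual R G) R).
Variable q : nat.
Local Notation C := (R[i]).
Implicit Types (F H : dual R G -> 'M[C]_q) (A : 'M[C]_q) (S : set G).
Local Notation lmul A F := (fun x => A *m F x).
Local Notation mono g A := (fun x : dual R G => x g *: A).

Lemma dual_eval0 (x : dual R G) : x 0 = 1.
Proof.
have [x1 xD] := dualP x; have := xD 0 0; rewrite addr0 => /esym/eqP.
have x0 : x 0 != 0 by rewrite -normr_gt0 x1.
by rewrite -subr_eq0 -{3}[x 0]mul1r -mulrBl mulf_eq0 (negPf x0) orbF subr_eq0 =>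
  /eqP.
Qed.

Lemma trigpoly0 S : trigpoly S (fun _ : dual R G => 0 : 'M[C]_q).
Proof. by exists [::], (fun=> 0); split=> //; apply/funext => x;
  rewrite big_nil. Qed.

Lemma trigpoly_mono S g A : S g -> trigpoly S (mono g A).
Proof.
move=> Sg; exists [:: g], (fun=> A); split=> [h|];
  first by rewrite inE => /eqP->.
by apply/funext => x; rewrite big_seq1.
Qed.

Lemma trigpoly_lmul S : lmul_closed (@trigpoly R G q S).
Proof.
move=> A _ [s [B [sS ->]]]; exists s, (fun g => A *m B g); split=> //.
by apply/funext => x; rewrite mulmx_sumr; apply: eq_bigr => g _;
  rewrite scalemxAr.
Qed.

(** Lets a sum be rewritten over a common list of frequencies, with
    multiplicities moved into the coefficients. *)
Lemma sum_count_undup (V : zmodType) (s t : seq G) (f : G -> V) :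
  {subset s <= t} -> \sum_(g <- s) f g = \sum_(g <- undup t) f g *+ count_mem g
    s.
Proof.
elim: s => [|h s ih] st.
  by rewrite big_nil big1// => g _; rewrite mulr0n.
rewrite big_cons ih => [|g gs]; last by apply: st; rewrite inE gs orbT.
have ht : h \in undup t by rewrite mem_undup st ?mem_head.
rewrite (bigD1_seq h)//= ?undup_uniq// [RHS](bigD1_seq h)//= ?undup_uniq//.
rewrite eqxx add1n mulrS addrA; congr (_ + _).
by apply: eq_bigr => g gh; rewrite eq_sym (negPf gh) add0n.
Qed.

Lemma trigpolyD S F H : trigpoly S F -> trigpoly S H -> trigpoly S (F \+ H).
Proof.
move=> [s [A [sS ->]]] [t [B [tS ->]]].
exists (undup (s ++ t)),
  (fun g => A g *+ count_mem g s + B g *+ count_mem g t); split.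
  by move=> g; rewrite mem_undup mem_cat => /orP[/sS|/tS].
apply/funext => x /=; under [RHS]eq_bigr do rewrite scalerDr -!scalerMnr.
rewrite big_split /=; congr (_ + _); apply: sum_count_undup => g gs.
  by rewrite mem_cat gs.
by rewrite mem_cat gs orbT.
Qed.

Lemma trigpoly_ind S (Q : (dual R G -> 'M[C]_q) -> Prop) : Q (fun=> 0) ->
  (forall g A, S g -> Q (mono g A)) -> (forall F H, Q F -> Q H -> Q (F \+ H)) ->
  trigpoly S `<=` Q.
Proof.
move=> Q0 Qm QD _ [s [A [sS ->]]]; elim: s sS => [|g s ih] sS.
  by rewrite (_ : (fun _ => _) = fun=> 0)//; apply/funext => x; rewrite big_nil.
rewrite (_ : (fun _ => _) = mono g (A g) \+
  (fun x : dual R G => \sum_(h <- s) x h *: A h)).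
  apply: QD; first by apply: Qm; apply: sS; exact: mem_head.
  by apply: ih => h hs; apply: sS; rewrite inE hs orbT.
by apply/funext => x; rewrite big_cons.
Qed.

Lemma mxmeasurable_mono g A : mxmeasurable (mono g A).
Proof.
move=> i j; under eq_fun do rewrite mxE.
by apply: cmeasurableM; [exact: cmeasurable_dual|exact: cmeasurable_cst].
Qed.

Lemma mxintegral_mono g A :
  mxintegral lambda (mono g A) = cintegral lambda (fun x : dual R G => x g) *:
    A.
Proof.
apply/matrixP => i j; rewrite !mxE mulrC -cintegralZ;
  last exact: cintegrable_dual.
by congr cintegral; apply/funext => x; rewrite mxE mulrC.
Qed.

Lemma cintegral_dual0 : cintegral lambda (fun x : dual R G => x 0) = 1.
Proof.
rewrite (_ : (fun _ => _) = fun=> 1); last by apply/funext => x;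
  exact: dual_eval0.
rewrite /cintegral /= !Rintegral_cst// mul0r mul1r.
by congr (_ +i* _); have := @probability_setT _ _ _ lambda;
  exact: (congr1 fine).
Qed.

Variable W : dual R G -> 'M[C]_q.
Hypothesis hW : weight lambda W.

Lemma mono_L2 g A : L2 lambda W (mono g A).
Proof.
apply: (sandwich_L2 (@mxmeasurable_mono g A)).
rewrite (_ : (fun _ => _) = (fun x => A *m (W x *m A^t*))).
  exact/mxintegrableMl/mxintegrableMr/hW.1.
apply/funext => x; rewrite adjZ -!scalemxAl -scalemxAr scalerA -normCK.
by have [-> _] := dualP x; rewrite expr1n scale1r mulmxA.
Qed.

Lemma L2_0 : L2 lambda W (fun=> 0).
Proof.
have := mono_L2 0 0; congr (L2 _ _ _).
by apply/funext => x; rewrite scaler0.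
Qed.

Lemma trigpoly_L2 S : trigpoly S `<=` L2 lambda W.
Proof.
apply: trigpoly_ind; [exact: L2_0|by move=> g A _; exact: mono_L2|].
by move=> F H; exact: L2D.
Qed.

Lemma Iconst_mono : Iconst q = mono 0 (1%:M : 'M[C]_q).
Proof. by apply/funext => x; rewrite dual_eval0 scale1r. Qed.

Lemma Iconst_L2 : L2 lambda W (Iconst q).
Proof. by rewrite Iconst_mono; exact: mono_L2. Qed.

End trigpoly.

(** * The prediction error and its dual description *)

Section main.
Variables (R : realType) (G : zmodType) (lambda : probability (dual R G) R).
Hypothesis haar : is_haar lambda.
Variable q : nat.
Local Notation C := (R[i]).
Variable W : dual R G -> 'M[C]_q.
Hypothesis tW : weight_tilde lambda W.
Variable S : set G.
Hypothesis S0 : S `<=` [set~ 0].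
Implicit Types (F H K : dual R G -> 'M[C]_q) (A : 'M[C]_q).
Local Notation lmul A F := (fun x => A *m F x).
Local Notation mono g A := (fun x : dual R G => x g *: A).
Local Notation L2W := (L2 lambda W).
Local Notation ip := (mxip lambda W).
Local Notation V := (invweight W).
Local Notation I := (Iconst q : dual R G -> 'M[C]_q).
Local Notation P := (PSI lambda W S).
Local Notation Z := (I \- P).
Local Notation Delta := (Delta lambda W S).
Local Notation MS := (MS lambda W).
Local Notation S0' := (S `|` [set 0]).
Let hW : weight lambda W := tW.1.
Let hV : weight lambda V := invweight_weight tW.
Let lV : L2W V := invweight_L2 tW.
Let lI : L2W I := Iconst_L2 hW.

Lemma MS_L2 U : MS U `<=` L2W.
Proof. by move=> F []. Qed.

Lemma PSI_is_orthproj : is_orthproj lambda W (MS S) I P.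
Proof.
apply: (@xgetPex _ (fun=> 0) [set Q | is_orthproj lambda W (MS S) I Q]).
exact: (exists_orthproj_L2closure tW (@trigpoly0 _ _ _ S) (@trigpolyD _ _ _ S)
  (@trigpoly_lmul _ _ _ S) (trigpoly_L2 hW (S := S)) lI).
Qed.

Let lP : L2W P := MS_L2 PSI_is_orthproj.1.
Let lZ : L2W Z := L2B hW lI lP.

Lemma mxip_residual_trigpoly H : trigpoly S H -> ip Z H = 0.
Proof.
apply: (is_orthproj_mxip hW (@trigpoly_lmul _ _ _ S) _ (@MS_L2 S) lI
  PSI_is_orthproj).
exact: (sub_L2closure hW (trigpoly_L2 hW (S := S))).
Qed.

Lemma mxip_residual H : MS S H -> ip Z H = 0.
Proof.
exact: (mxip_closure_eq0 hW (trigpoly_L2 hW (S := S)) lZ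
  mxip_residual_trigpoly).
Qed.

Lemma mxip_inv_mono g A : g <> 0 -> ip V (mono g A) = 0.
Proof.
move=> g0; have lm := mono_L2 hW g A.
rewrite (mxip_adj hW lm lV) (mxip_invweight tW lm) mxintegral_mono.
by rewrite (cintegral_dual_eq0 haar g0) scale0r adj0.
Qed.

Lemma mxip_zero F : L2W F -> ip F (fun=> 0) = 0.
Proof.
move=> lF; have e : (fun=> 0) = lmul 0 F :> (dual R G -> 'M[C]_q) by
  apply/funext => x; rewrite mul0mx.
by rewrite e (mxipMr hW 0 lF lF) adj0 mulmx0.
Qed.

Lemma mxip_inv_trigpoly H : trigpoly S H -> ip V H = 0.
Proof.
move=> tH; suff [] : L2W H /\ ip V H = 0 by [].
move: H tH; apply: trigpoly_ind => [|g A Sg|F H [lF F0] [lH H0]].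
- exact: (conj (L2_0 hW) (mxip_zero lV)).
- exact: (conj (mono_L2 hW g A) (mxip_inv_mono A (S0 Sg))).
- split; first exact: (L2D hW lF lH).
  by rewrite (mxipDr hW lF lH lV) F0 H0 addr0.
Qed.

Lemma mxip_inv_MS H : MS S H -> ip V H = 0.
Proof.
exact: (mxip_closure_eq0 hW (trigpoly_L2 hW (S := S)) lV mxip_inv_trigpoly).
Qed.

Lemma mxip_inv_const : ip I V = 1%:M.
Proof.
rewrite (mxip_invweight tW lI) Iconst_mono mxintegral_mono.
by rewrite cintegral_dual0 scale1r.
Qed.

Lemma mxip_residual_inv : ip Z V = 1%:M.
Proof.
rewrite (mxipBl hW lI lP lV) mxip_inv_const (mxip_adj hW lV lP).
by rewrite (mxip_inv_MS PSI_is_orthproj.1) adj0 subr0.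
Qed.

(** The fitted part [P_S I] is orthogonal to the residual. *)
Lemma mxip_residual_const : ip Z I = Delta.
Proof.
rewrite /Defs.Delta (mxipBr hW lI lP lZ).
by rewrite (mxip_residual PSI_is_orthproj.1) subr0.
Qed.

Lemma Delta_adj : Delta^t* = Delta.
Proof. by rewrite /Defs.Delta -(mxip_adj hW lZ lZ). Qed.

(** If [A Delta = 0], the residual is killed by [A]; but its integral is the
    identity. *)
Lemma Delta_mul_inj A : A *m Delta = 0 -> A = 0.
Proof.
move=> AD; have lAZ := L2Ml hW A lZ.
have : rdot lambda W (lmul A Z) (lmul A Z) = 0.
  rewrite /rdot /scalar_prod (mxipMl hW A lZ lAZ) (mxipMr hW A lZ lZ) mulmxA.
  by rewrite [A *m _]AD mul0mx ntr0.
move=> /(rdot_eq0 hW lAZ) AZ0.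
rewrite -[A]mulmx1 -mxip_residual_inv -(mxipMl hW A lZ lV)
  (mxip_invweight tW lAZ).
rewrite (@eq_ae_mxintegral _ _ _ _ _ _ (fun=> 0) (mxmeasurable_L2 lAZ) _ AZ0).
  by apply/matrixP => i j; rewrite !mxE; exact: cintegral0.
exact: mxmeasurable_cst.
Qed.

Lemma Delta_unit : Delta \in unitmx.
Proof.
by rewrite -row_free_unit -kermx_eq0; apply/eqP/Delta_mul_inj/mulmx_ker.
Qed.

Local Notation Di := (invmx Delta).
Local Notation E' := (fun x => (Di *m Z x) *m W x).

Let lDZ : L2W (lmul Di Z) := L2Ml hW Di lZ.

Lemma candidate_L2 : L2 lambda V E'.
Proof. exact: (L2_mulr_weight tW lDZ). Qed.

(** This is where [Delta^-1] comes from: it is the coefficient that makes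
    [V - Delta^-1 Z] orthogonal to the constants, both [V] and [Z] being
    orthogonal to [T(S)]. *)
Lemma mxip_dual_witness H : MS S0' H -> ip (V \- lmul Di Z) H = 0.
Proof.
have lB := L2B hW lV lDZ.
apply: (mxip_closure_eq0 hW (trigpoly_L2 hW (S := S0')) lB) => {}H tH.
suff [] : L2W H /\ ip (V \- lmul Di Z) H = 0 by [].
move: H tH; apply: trigpoly_ind => [|g A Sg|F H [lF F0] [lH H0]].
- exact: (conj (L2_0 hW) (mxip_zero lB)).
- have lm := mono_L2 hW g A; split; first exact: lm.
  rewrite (mxipBl hW lV lDZ lm) (mxipMl hW Di lZ lm).
  case: Sg => [Sg|->].
    rewrite (mxip_inv_mono A (S0 Sg))
      (mxip_residual_trigpoly (trigpoly_mono A Sg)).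
    by rewrite mulmx0 subr0.
  have e : mono 0 A = lmul A I.
    by apply/funext => x; rewrite dual_eval0 scale1r mulmx1.
  rewrite e (mxipMr hW A lV lI) (mxipMr hW A lZ lI) mxip_residual_const.
  by rewrite (mxip_adj hW lI lV) mxip_inv_const adj1 mul1mx mulKmx ?Delta_unit//
    subrr.
- split; first exact: (L2D hW lF lH).
  by rewrite (mxipDr hW lF lH lB) F0 H0 addr0.
Qed.

Lemma candidate_dualmod : dualmod lambda W (MS S0') (I \- E').
Proof.
have lIV : L2 lambda V I := Iconst_L2 hV.
have lB := L2B hV lIV candidate_L2; split; first exact: lB.
move=> F MF; have lF := MS_L2 MF; have lBD := L2B hW lV lDZ.
rewrite (mxintegral_mul_adj tW lF lB).
have lBV := L2_mulr_invweight tW lB.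
transitivity (ip F (V \- lmul Di Z)); last first.
  by rewrite (mxip_adj hW lBD lF) (mxip_dual_witness MF) adj0.
apply: eq_ae_mxintegral.
- exact: (mxmeasurable_sandwich hW (mxmeasurable_L2 lF) (mxmeasurable_L2 lBV)).
- exact: (mxmeasurable_sandwich hW (mxmeasurable_L2 lF) (mxmeasurable_L2 lBD)).
- apply: filterS (mulr_weightK tW (lmul Di Z)) => x e.
  by rewrite /= mulmxBl mul1mx e.
Qed.

Lemma const_MS0 : MS S0' I.
Proof.
apply: (sub_L2closure hW (trigpoly_L2 hW (S := S0'))).
by rewrite Iconst_mono; apply: trigpoly_mono; right.
Qed.

Lemma MS_mono U U' : U `<=` U' -> MS U `<=` MS U'.
Proof.
move=> UU' F [lF clF]; split=> // e /clF[H [s [A [sU ->]]] h].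
by exists (fun x : dual R G => \sum_(g <- s) x g *: A g) => //;
  exists s, A; split=> // g /sU /UU'.
Qed.

(** [Z] lies in [M(S^0)], as the difference of [I] and [P_S I]. *)
Lemma candidate_orth H : dualmod lambda W (MS S0') H -> mxip lambda V E' H = 0.
Proof.
move=> [lH oH]; rewrite (mxip_mulr_weight_l tW lDZ lH).
have lHV := L2_mulr_invweight tW lH.
have MP : MS S0' P by apply: MS_mono PSI_is_orthproj.1 => g; left.
have h F : L2W F -> MS S0' F -> ip F (fun x => H x *m V x) = 0.
  by move=> lF MF; rewrite -(mxintegral_mul_adj tW lF lH) oH.
rewrite (mxipMl hW Di lZ lHV) (mxipBl hW lI lP lHV) (h _ lI const_MS0).
by rewrite (h _ lP MP) subrr mulmx0.
Qed.

Lemma candidate_is_orthproj :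
  is_orthproj lambda V (dualmod lambda W (MS S0')) I (I \- E').
Proof.
split; first exact: candidate_dualmod.
move=> H dH; have -> : I \- (I \- E') = E'.
  by apply/funext => x /=; rewrite opprB addrC subrK.
by rewrite /scalar_prod (candidate_orth dH) ntr0.
Qed.

Lemma Itilde_is_orthproj :
  is_orthproj lambda V (dualmod lambda W (MS S0')) I (Itilde lambda W S).
Proof.
apply: (@xgetPex _ (fun=> 0) [set Q | is_orthproj lambda V _ I Q]).
by exists (I \- E'); exact: candidate_is_orthproj.
Qed.

Lemma Itilde_residual_ae :
  {ae lambda, forall x, (I \- Itilde lambda W S) x = Di *m Z x *m W x}.
Proof.
have lIV : L2 lambda V I := Iconst_L2 hV.
have ML : dualmod lambda W (MS S0') `<=` L2 lambda V by move=> F [].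
have MB H K := @dualmodB _ _ _ _ lambda W (MS S0') H K tW (@MS_L2 S0').
have := is_orthproj_unique hV ML MB lIV Itilde_is_orthproj
  candidate_is_orthproj.
by apply: filterS => x /= ->; rewrite opprB addrC subrK.
Qed.

Local Notation E := (I \- Itilde lambda W S).

Lemma Itilde_residual_L2 : L2 lambda V E.
Proof. exact: (L2B hV (Iconst_L2 hV) Itilde_is_orthproj.1.1). Qed.

Lemma mxip_Itilde_const : mxip lambda V E I = Di.
Proof.
have lIV : L2 lambda V I := Iconst_L2 hV.
have -> : mxip lambda V E I = mxip lambda V E' I.
  apply: eq_ae_mxintegral.
  - exact: (mxmeasurable_sandwich hV (mxmeasurable_L2 Itilde_residual_L2)
    (mxmeasurable_L2 lIV)).
  - exact: (mxmeasurable_sandwich hV (mxmeasurable_L2 candidate_L2)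
    (mxmeasurable_L2 lIV)).
  - by apply: filterS Itilde_residual_ae => x ->.
rewrite (mxip_mulr_weight_l tW lDZ lIV).
have -> : (fun x => I x *m V x) = V by apply/funext => x; rewrite mul1mx.
by rewrite (mxipMl hW Di lZ lV) mxip_residual_inv mulmx1.
Qed.

Lemma mxip_Itilde_residual : mxip lambda V E E = Di.
Proof.
have -> : mxip lambda V E E = mxip lambda V E' E'.
  apply: eq_ae_mxintegral.
  - exact: (mxmeasurable_sandwich hV (mxmeasurable_L2 Itilde_residual_L2)
    (mxmeasurable_L2 Itilde_residual_L2)).
  - exact: (mxmeasurable_sandwich hV (mxmeasurable_L2 candidate_L2)
    (mxmeasurable_L2 candidate_L2)).
  - by apply: filterS Itilde_residual_ae => x ->.
rewrite (mxip_mulr_weight tW lDZ lDZ) (mxipMl hW Di lZ lDZ)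
  (mxipMr hW Di lZ lZ).
rewrite mulmxA -/(Defs.Delta lambda W S) mulVmx ?Delta_unit// mul1mx.
have := mulmxV Delta_unit => /(congr1 (fun M => M^t* *m Di)).
by rewrite adjM Delta_adj adj1 mul1mx -mulmxA mulmxV ?Delta_unit// mulmx1.
Qed.

End main.

Theorem theorem3p2 (R : realType) (G : zmodType)
    (lambda : probability (dual R G) R) (haar_lambda : is_haar lambda)
    (q : nat) (q_gt0 : (0 < q)%N)
    (W : dual R G -> 'M[R[i]]_q) (hW : weight_tilde lambda W)
    (S : set G) (hS : S `<=` [set~ 0]) :
  let E : dual R G -> 'M[R[i]]_q := Iconst q \- Itilde lambda W S in
  let D1 := mxip lambda (invweight W) E (Iconst q) in
  let D2 := mxip lambda (invweight W) E E in
  [/\ D1 \in unitmx,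
      D2 \in unitmx,
      {ae lambda, forall x,
        PSI lambda W S x = 1%:M - invmx D1 *m E x *m invmx (W x)},
      Delta lambda W S = invmx D1
    & invmx D1 = invmx D2].
Proof.
move=> E D1 D2; have uD := Delta_unit haar_lambda hW hS.
have e1 : D1 = invmx (Delta lambda W S) := mxip_Itilde_const haar_lambda hW hS.
have e2 : D2 = invmx (Delta lambda W S) :=
  mxip_Itilde_residual haar_lambda hW hS.
rewrite e1 e2 invmxK unitmx_inv; split=> //.
apply: filterS2 (Itilde_residual_ae haar_lambda hW hS) hW.1.2 => x e Wx.
rewrite {1}/E e -!mulmxA mulmxV ?posdef_unit// mulmx1 mulKVmx//.
by rewrite /= opprB addrC subrK.
Qed.
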